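(* Let $n\ge 5$ and let $K$ and $L$ be two convex bodies in $\mathbb{R}^n$, each having countably many diameters. Assume that there exists a direction $\zeta\in S^{n-1}$ such that $K$ has a diameter $d_K(\zeta)$ parallel to $\zeta$ and such that, for every four dimensional linear subspace $H$ of $\mathbb{R}^n$ containing $\zeta$, the projections $K|H$ and $L|H$ are directly congruent. Assume also that, for every such $H$, the projections $K|H$ and $L|H$ have no $SO(4)$ symmetries, and the three dimensional projections $K|(H\cap\zeta^\perp)$ and $L|(H\cap\zeta^\perp)$ have no $O(3)$ symmetries. Then $K=L+b$ or $K=-L+b$ for some $b\in\mathbb{R}^n$.
   Context: A body is a compact set which is equal to the closure of its non-empty interior; a convex body is a body that is convex. For a convex body $K\subset\mathbb{R}^n$, $h_K(x)=\max\{x\cdot y: y\in K\}$ is its support function and $\omega_K(x)=h_K(x)+h_K(-x)$, $x\in S^{n-1}$, its width function. A segment $[z,y]\subset K$ is a diameter of the convex body $K$ if $|z-y|=\max_{\theta\in S^{n-1}}\omega_K(\theta)$. A convex body $K$ has countably many diameters if $\omega_K$ attains its maximum on a countable (possibly finite) subset of $S^{n-1}$. A convex body has at most one diameter parallel to a given direction $\zeta\in S^{n-1}$; if it exists it is denoted $d_K(\zeta)$. $\zeta^\perp$ is the hyperplane through the origin orthogonal to $\zeta$. $K|H$ is the orthogonal projection of $K$ onto the linear subspace $H$. Here $O(k,H)$ and $SO(k,H)$ denote the orthogonal and special orthogonal groups of a $k$ dimensional subspace $H$. Two subsets $D,B$ of a $k$ dimensional subspace $H$ are directly congruent if $\varphi(D)=B+a$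 for some $a\in H$ and some $\varphi\in SO(k,H)$. A set $D\subset H$ has an $SO(k)$ symmetry (respectively, an $O(k)$ symmetry) if $\varphi(D)=D+a$ for some $a\in H$ and some non-identity $\varphi\in SO(k,H)$ (respectively, $\varphi\in O(k,H)$). *)

(* Defs.v *)
From HB Require Import structures.
From mathcomp Require Import all_boot all_order all_algebra.
From mathcomp Require Import all_classical all_reals all_analysis.
Set Implicit Arguments.
Unset Strict Implicit.
Unset Printing Implicit Defensive.
Import Order.TTheory GRing.Theory Num.Theory.
Import numFieldNormedType.Exports.
Local Open Scope classical_set_scope.
Local Open Scope ring_scope.

(* R^n is 'rV[R]_n.  The norm that the library puts
   on matrices is the sup norm: it is only used through its topology (compact,
   interior, closure).  All metric notions below are Euclidean. *)

Definition dotv (R : realType) (n : nat) (u v : 'rV[R]_n) : R :=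
  \sum_(i < n) u 0 i * v 0 i.

Definition enorm (R : realType) (n : nat) (u : 'rV[R]_n) : R :=
  Num.sqrt (dotv u u).

Definition usphere (R : realType) (n : nat) : set 'rV[R]_n :=
  [set u | enorm u = 1].

Definition body (R : realType) (n : nat) (K : set 'rV[R]_n) : Prop :=
  [/\ compact K, K° !=set0 & K = closure K°].

Definition convex_body (R : realType) (n : nat) (K : set 'rV[R]_n) : Prop :=
  body K /\ convex_set K.

(* For K compact and nonempty this supremum is a maximum. *)
Definition support_fun (R : realType) (n : nat) (K : set 'rV[R]_n)
    (x : 'rV[R]_n) : R :=
  sup [set dotv x y | y in K].

Definition width (R : realType) (n : nat) (K : set 'rV[R]_n)
    (x : 'rV[R]_n) : R :=
  support_fun K x + support_fun K (- x).

Definition max_width_dirs (R : realType) (n : nat) (K : set 'rV[R]_n) :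
    set 'rV[R]_n :=
  [set u | usphere u /\ forall v, usphere v -> width K v <= width K u].

Definition segment (R : realType) (n : nat) (z y : 'rV[R]_n) : set 'rV[R]_n :=
  [set (1 - t) *: z + t *: y | t in [set t : R | 0 <= t <= 1]].

Definition is_diameter (R : realType) (n : nat) (K : set 'rV[R]_n)
    (z y : 'rV[R]_n) : Prop :=
  segment z y `<=` K /\
  exists2 u, max_width_dirs K u & enorm (z - y) = width K u.

Definition countably_many_diameters (R : realType) (n : nat)
    (K : set 'rV[R]_n) : Prop :=
  countable (max_width_dirs K).

Definition has_diameter_parallel (R : realType) (n : nat) (K : set 'rV[R]_n)
    (zeta : 'rV[R]_n) : Prop :=
  exists z y, is_diameter K z y /\ exists t : R, z - y = t *: zeta.

Definition orthv (R : realType) (n : nat) (zeta : 'rV[R]_n) :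
    {vspace 'rV[R]_n} :=
  lker (linfun (mulmxr zeta^T : 'rV[R]_n -> 'rV[R]_1)).

Lemma mem_orthv (R : realType) (n : nat) (zeta x : 'rV[R]_n) :
  (x \in orthv zeta) = (dotv x zeta == 0).
Proof.
rewrite memv_ker lfunE /=; apply/eqP/eqP => [/matrixP/(_ 0 0)|x0].
  by rewrite !mxE => <-; apply: eq_bigr => i _; rewrite mxE.
apply/matrixP => i j; rewrite !ord1 !mxE -[RHS]x0.
by apply: eq_bigr => k _; rewrite mxE.
Qed.

Definition oproj (R : realType) (n : nat) (K : set 'rV[R]_n)
    (H : {vspace 'rV[R]_n}) : set 'rV[R]_n :=
  [set y | y \in H /\
    exists2 x, K x & forall v, v \in H -> dotv (x - y) v = 0].

Definition in_O (R : realType) (n : nat) (H : {vspace 'rV[R]_n})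
    (phi : 'End(subvs_of H)) : Prop :=
  forall u v, dotv (vsval (phi u)) (vsval (phi v)) = dotv (vsval u) (vsval v).

(* The matrix of phi is taken in the same basis of H on both sides, so its
   determinant does not depend on that basis. *)
Definition in_SO (R : realType) (n : nat) (H : {vspace 'rV[R]_n})
    (phi : 'End(subvs_of H)) : Prop :=
  let e := vbasis {:subvs_of H} in in_O phi /\ \det (passmx.mxof e e phi) = 1.

(* phi(D), for a subset D of H viewed as a subset of R^n. *)
Definition subspace_image (R : realType) (n : nat) (H : {vspace 'rV[R]_n})
    (phi : 'End(subvs_of H)) (D : set 'rV[R]_n) : set 'rV[R]_n :=
  [set vsval (phi u) | u in [set u | D (vsval u)]].

Definition translate (R : realType) (n : nat) (D : set 'rV[R]_n)
    (a : 'rV[R]_n) : set 'rV[R]_n :=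
  [set x + a | x in D].

Definition directly_congruent (R : realType) (n : nat)
    (H : {vspace 'rV[R]_n}) (D B : set 'rV[R]_n) : Prop :=
  exists (phi : 'End(subvs_of H)) (a : 'rV[R]_n),
    [/\ in_SO phi, a \in H & subspace_image phi D = translate B a].

(* The group SO(k, H) and, below, O(k, H), with k = \dim H. *)
Definition has_SO_symmetry (R : realType) (n : nat)
    (H : {vspace 'rV[R]_n}) (D : set 'rV[R]_n) : Prop :=
  exists (phi : 'End(subvs_of H)) (a : 'rV[R]_n),
    [/\ in_SO phi, phi <> \1%VF, a \in H
      & subspace_image phi D = translate D a].

Definition has_O_symmetry (R : realType) (n : nat)
    (H : {vspace 'rV[R]_n}) (D : set 'rV[R]_n) : Prop :=
  exists (phi : 'End(subvs_of H)) (a : 'rV[R]_n),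
    [/\ in_O phi, phi <> \1%VF, a \in H
      & subspace_image phi D = translate D a].

(* Main.v *)
Require Import Defs.
From HB Require Import structures.
From mathcomp Require Import all_boot all_order all_algebra.
From mathcomp Require Import all_classical all_reals all_analysis.
From mathcomp Require Import ring lra.
Set Implicit Arguments.
Unset Strict Implicit.
Unset Printing Implicit Defensive.
Import Order.TTheory GRing.Theory Num.Theory.
Import numFieldNormedType.Exports.
Local Open Scope classical_set_scope.
Local Open Scope ring_scope.

(** Write h_K for the support function of K, and E for the hyperplane orthogonal
    to zeta.  The 4-dimensional spaces H through zeta are the sums of the line of
    zeta and of a 3-dimensional subspace W of E.

    On H, a congruence of K|H and L|H is an identity
    h_K(x) = h_L(phi x) + (linear form), so the widths of K and L correspond under
    phi, and phi zeta is a direction of maximal width of L.  There are countably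
    many such directions, so a generic H contains no other than zeta and - zeta,
    and phi zeta = zeta or - zeta: phi is rho on W and \det rho on zeta, with rho
    in O(W) ([good_block]).  Translate K and L so that their diameters parallel
    to zeta are centred at the origin.  The two support functions then agree to
    first order at zeta ([midpoint_bounds]), which leaves no room for the linear
    form ([centered_congruence]): the translated functions F and G satisfy
    F = G o phi on H.

    Fix now a 4-dimensional subspace E' of E and identify it with the quaternions.
    A unit quaternion w gives the subspace W orthogonal to w, with the orthonormal
    basis i w, j w, k w ([qframe]), so rho becomes a matrix rho_w of O(3).  Since
    K|W has no symmetries, rho_w is unique; as O(3) is compact, rho_w exists for
    every w, generic or not, and is a continuous function of w, whence \det rho_w
    is a constant e.  The subspaces W through a given u of E' are those of w = c u
    with c a unit imaginary quaternion, and c is, up to sign, the vector of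
    coordinates of u in W.  The map sending c to rho_w is continuous and even on
    the sphere S^2, and such a map satisfies c rho_w = e c for some c: this is
    [even_orthogonal_fixpoint], a relative of the hairy ball theorem obtained by
    comparing winding numbers at the pole and on the equator.  Hence
    F(u) = G(e u) for all u in E', and by uniqueness rho_w = e for all w: F and
    G(e .) agree on the span of zeta and E' ([signed_congruence]).

    Any two vectors belong to the span of zeta and a common E', so the sign e is
    the same for all E'.  Therefore h_K is h_L or h_{-L} up to a linear form, and
    a compact convex set is determined by its support function
    ([support_separation]). *)

(** * Arguments and winding numbers of plane curves *)

(** The complex number (a + ib) e^(-it) is a positive real: t is an argument
    of a + ib.  This form needs neither a modulus nor a quotient. *)
Definition is_arg (R : realType) (a b t : R) : Prop :=
  0 < a * cos t + b * sin t /\ b * cos t = a * sin t.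

Lemma is_arg_atan (R : realType) (a b : R) : 0 < a -> is_arg a b (atan (b / a)).
Proof.
move=> a0; have c0 : 0 < cos (atan (b / a)).
  by apply: cos_gt0_pihalf; rewrite atan_gtNpi2 atan_ltpi2.
have st : sin (atan (b / a)) = b / a * cos (atan (b / a)).
  by rewrite -[X in _ = X * _](atanK (b / a)) /tan mulfVK// gt_eqF.
rewrite /is_arg st; split.
  rewrite mulrA -mulrDl mulr_gt0// ltr_wpDr//.
  by rewrite mulrA -expr2 divr_ge0 ?sqr_ge0 ?ltW.
by rewrite mulrA [a * _]mulrC divfK ?gt_eqF.
Qed.

(** Multiplying (a', b') by the conjugate of (a, b) subtracts arguments, so an
    argument of the product corrects t into an argument of (a', b'). *)
Lemma is_argM (R : realType) (a b a' b' t t' : R) : is_arg a b t ->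
  is_arg (a' * a + b' * b) (b' * a - a' * b) t' -> is_arg a' b' (t + t').
Proof.
rewrite /is_arg cosD sinD => -[]; have := cos2Dsin2 t.
move: (cos t) (sin t) (cos t') (sin t') => c s c' s' cs1 p e [p' e'].
pose r := a * c + b * s.
have ea : a = r * c by rewrite /r; rewrite -[LHS]mulr1 -cs1; ring: e.
have eb : b = r * s by rewrite /r; rewrite -[LHS]mulr1 -cs1; ring: e.
have r0 : 0 < r by [].
move: p' e'; rewrite ea eb => p' e'; split.
  by rewrite -(pmulr_rgt0 _ r0); move: p'; congr (0 < _); ring.
apply: (mulfI (lt0r_neq0 r0)); apply/eqP; rewrite -subr_eq0; apply/eqP.
move/eqP: e'; rewrite -subr_eq0 => /eqP <-; ring.
Qed.

(** Conjugate numbers have opposite arguments modulo 2 pi. *)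
Lemma is_arg_conj (R : realType) (a b t t' : R) : is_arg a b t ->
  is_arg a (- b) t' -> cos (t + t') = 1.
Proof.
rewrite /is_arg cosD => -[]; have := cos2Dsin2 t; have := cos2Dsin2 t'.
move: (cos t) (sin t) (cos t') (sin t') => c s c' s' cs1' cs1 p e [p' e'].
pose r := a * c + b * s; have r0 : 0 < r by [].
have ea : a = r * c by rewrite /r; rewrite -[LHS]mulr1 -cs1; ring: e.
have eb : b = r * s by rewrite /r; rewrite -[LHS]mulr1 -cs1; ring: e.
move: p' e'; rewrite ea eb => p' e'.
have z : s * c' + c * s' = 0.
  by apply: (mulfI (lt0r_neq0 r0)); lra.
have pos : 0 < c * c' - s * s'.
  by rewrite -(pmulr_rgt0 _ r0); move: p'; congr (0 < _); ring.
have : (c * c' - s * s') ^+ 2 = 1.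
  have -> : (c * c' - s * s') ^+ 2 =
    (c ^+ 2 + s ^+ 2) * (c' ^+ 2 + s' ^+ 2) - (s * c' + c * s') ^+ 2 by ring.
  by rewrite cs1 cs1' z mulr1 expr0n subr0.
move/eqP; rewrite sqrf_eq1 => /orP[/eqP//|/eqP h]; lra.
Qed.

(** The solutions of cos x = 1 are isolated, so by the intermediate value
    theorem a continuous function cannot move between two of them. *)
Lemma cos1_const (R : realType) (g : R -> R) : continuous g ->
  (forall t, cos (g t) = 1) -> forall s t, g s = g t.
Proof.
move=> gc g1.
have key s t : g s < g t -> False.
  move=> lt; pose d := Num.min 1 (g t - g s).
  have d0 : 0 < d by rewrite /d lt_min ltr01 subr_gt0.
  have d1 : d <= 1 by rewrite /d ge_min lexx.
  have dt : g s + d <= g t by rewrite -lerBrDl /d ge_min lexx orbT.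
  have [x xe] : exists x, g x = g s + d.
    have gs : g s <= g s + d by rewrite lerDl ltW.
    have cg a b : {within `[a, b], continuous g} by apply: continuous_subspaceT.
    case: (leP s t) => [st|/ltW st].
      have [|x _] := @IVT _ g s t (g s + d) st (cg _ _); last by exists x.
      by rewrite ge_min gs le_max dt orbT.
    have [|x _] := @IVT _ g t s (g s + d) st (cg _ _); last by exists x.
    by rewrite ge_min gs le_max dt orbT.
  have := g1 x; rewrite xe cosD g1 mul1r => h.
  have s0 : sin (g s) = 0.
    by apply/eqP; rewrite -sqrf_eq0 sin2cos2 g1 expr1n subrr.
  move: h; rewrite s0 mul0r subr0 => /eqP; rewrite -cos0 => /eqP h.
  have : d = 0.
    apply: cos_inj h; rewrite in_itv/= ?lexx ?pi_ge0// (ltW d0).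
    by rewrite (le_trans d1)// (le_trans _ (pi_ge2 R))// ler1n.
  by move=> d0'; rewrite d0' ltxx in d0.
by move=> s t; case: (ltgtP (g s) (g t)) => // /key.
Qed.

(** The curve (a, b), of period 2 pi, turns around the origin: it has a
    continuous argument that grows by k over a period. *)
Definition winds (R : realType) (k : R) (a b : R -> R) : Prop :=
  exists w : R -> R, [/\ continuous w, forall t, is_arg (a t) (b t) (w t)
    & forall t, w (t + pi *+ 2) = w t + k].

(** The two curves stay within a right angle of each other, so the angle from one
    to the other is an arctangent: continuous and periodic, hence without effect
    on the growth of the argument. *)
Lemma winds_near (R : realType) (k : R) (a b a' b' : R -> R) :
  continuous a -> continuous b -> continuous a' -> continuous b' ->
  (forall t, a (t + pi *+ 2) = a t) -> (forall t, b (t + pi *+ 2) = b t) ->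
  (forall t, a' (t + pi *+ 2) = a' t) -> (forall t, b' (t + pi *+ 2) = b' t) ->
  (forall t, 0 < a' t * a t + b' t * b t) -> winds k a b -> winds k a' b'.
Proof.
move=> ca cb ca' cb' pa pb pa' pb' pos [w [cw aw pw]].
pose f t := atan ((b' t * a t - a' t * b t) / (a' t * a t + b' t * b t)).
exists (fun t => w t + f t); split.
- move=> t; apply: cvgD; first exact: cw.
  apply: (@continuous_comp _ _ _
    (fun t => (b' t * a t - a' t * b t) / (a' t * a t + b' t * b t)) (@atan R));
    last exact: continuous_atan.
  apply: cvgM.
    by apply: cvgB; apply: cvgM; [exact: cb'|exact: ca|exact: ca'|exact: cb].
  apply: cvgV; first by rewrite gt_eqF.
  by apply: cvgD; apply: cvgM; [exact: ca'|exact: ca|exact: cb'|exact: cb].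
- by move=> t; apply: is_argM (aw t) _; apply: is_arg_atan.
- by move=> t; rewrite /f pw pa pb pa' pb' addrAC.
Qed.

Lemma periodic_reduce (R : realType) (T : R) (g : R -> R) : 0 < T ->
  (forall t, g (t + T) = g t) ->
  forall t, exists2 s, s \in `[0, T] & g s = g t.
Proof.
move=> T0 gT.
have gZ (z : int) t : g (t + T *~ z) = g t.
  case: z => n; first exact: periodicn.
  by rewrite NegzE mulrNz -[RHS](congr1 g (subrK (T *+ n.+1) t)) periodicn.
move=> t; exists (t + T *~ (- Num.floor (t / T))); last exact: gZ.
rewrite in_itv/= mulrNz -mulrzr.
have /andP[h1 h2] := Num.Theory.floor_itv (t / T).
rewrite subr_ge0 mulrC -ler_pdivlMr// h1/= lerBlDr.
by rewrite -[X in X + _]mul1r -mulrDl -ler_pdivrMr// addrC ltW// -intrD1.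
Qed.

(** Homotopy invariance of the winding number.  By compactness of a period, the
    curves of nearby parameters stay within a right angle of each other, so
    winding by k is both an open and a closed condition on the parameter. *)
Lemma winds_homotopy (R : realType) (k : R) (a b : R -> R -> R) :
  continuous (fun p : R * R => a p.1 p.2) ->
  continuous (fun p : R * R => b p.1 p.2) ->
  (forall p t, a p (t + pi *+ 2) = a p t) ->
  (forall p t, b p (t + pi *+ 2) = b p t) ->
  (forall p t, 0 < a p t ^+ 2 + b p t ^+ 2) ->
  forall p q, winds k (a p) (b p) -> winds k (a q) (b q).
Proof.
move=> ca cb pa pb ab0.
have T0 : 0 < pi *+ 2 :> R by rewrite mulrn_wgt0 ?pi_gt0.
have c1 (f : R -> R -> R) : continuous (fun p : R * R => f p.1 p.2) ->
    forall p, continuous (f p).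
  move=> cf p t; apply: (@continuous2_cvg _ _ _ _ _ _ (fun=> p) id f p t (cf (p, t))).
    exact: cvg_cst.
  exact: cvg_id.
have key p : \forall q \near p, forall t, 0 < a q t * a p t + b q t * b p t.
  have /compact_near_coveringP cpt := @segment_compact R 0 (pi *+ 2).
  have cov t : `[0, pi *+ 2]%classic t -> \forall t' \near t & q \near p,
      0 < a q t' * a p t' + b q t' * b p t'.
    move=> _; pose f (z : R * R) := a z.2 z.1 * a p z.1 + b z.2 z.1 * b p z.1.
    have cf (g : R -> R -> R) : continuous (fun p : R * R => g p.1 p.2) ->
        (fun z : R * R => g z.2 z.1 * g p z.1) @ (t, p) --> g p t * g p t.
      move=> cg; apply: cvgM.
        apply: (@continuous2_cvg _ _ _ _ _ _ snd fst g p t (cg (p, t))).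
          exact: cvg_snd.
        exact: cvg_fst.
      apply: (@continuous_cvg _ _ _ _ _ fst (g p)); first exact: c1.
      exact: cvg_fst.
    have : f @ (t, p) --> a p t * a p t + b p t * b p t.
      by apply: cvgD; apply: cf.
    by move=> /cvgr_gt; apply; rewrite -!expr2.
  have := cpt R (nbhs p) (fun q t => 0 < a q t * a p t + b q t * b p t)
    (nbhs_filter p) cov.
  apply: (@filterS _ (nbhs p)) => q h t.
  pose g t := a q t * a p t + b q t * b p t.
  have [|s s0 e] := periodic_reduce (g := g) T0 _ t.
    by move=> u; rewrite /g !pa !pb.
  by rewrite -/(g t) -e; exact: h.
have trans p q : (forall t, 0 < a q t * a p t + b q t * b p t) ->
    winds k (a p) (b p) -> winds k (a q) (b q).
  by move=> h; apply: winds_near => //; exact: c1.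
move=> p q wp.
have cR : connected [set: R] by apply/connected_intervalP => ? ? ? ?.
pose U := [set p | winds k (a p) (b p)].
suff : U = setT by move=> /seteqP[_ h]; exact: h.
apply: cR; first by exists p.
  exists U; last by rewrite setTI.
  rewrite openE => r Ur; apply: filterS (key r) => s h.
  exact: trans Ur.
exists U; last by rewrite setTI.
rewrite -[U]setCK; apply: open_closedC; rewrite openE => r Ur.
apply: filterS (key r) => s h Us; apply: Ur; apply: trans Us => t.
by rewrite [a r t * _]mulrC [b r t * _]mulrC.
Qed.

(** * Limits of matrices *)

Lemma cvg_mx (R : realType) (T : Type) (F : set_system T) (m n : nat)
    (f : T -> 'M[R]_(m, n)) (M : 'M[R]_(m, n)) : Filter F ->
  (forall i j, f x i j @[x --> F] --> M i j) -> f x @[x --> F] --> M.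
Proof.
move=> FF h A [P MP PA]; rewrite /nbhs/=.
have FQ : F [set x | forall k : 'I_m * 'I_n, P k.1 k.2 (f x k.1 k.2)].
  by apply: filter_forall => -[i j]; exact: (h i j _ (MP i j)).
by apply: filterS FQ => x Qx; apply: PA => i j; exact: (Qx (i, j)).
Qed.

Lemma cvg_coord (R : realType) (T : Type) (F : set_system T) (m n : nat)
    (f : T -> 'M[R]_(m, n)) (M : 'M[R]_(m, n)) : Filter F ->
  f x @[x --> F] --> M -> forall i j, f x i j @[x --> F] --> M i j.
Proof.
move=> FF h i j.
apply: (@continuous_cvg _ _ _ _ _ f (fun M : 'M[R]_(m, n) => M i j)) => //.
exact: coord_continuous.
Qed.

Lemma cvg_mulmx (R : realType) (T : Type) (F : set_system T) (m n p : nat)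
    (f : T -> 'M[R]_(m, n)) (g : T -> 'M[R]_(n, p))
    (A : 'M[R]_(m, n)) (B : 'M[R]_(n, p)) : Filter F ->
  f x @[x --> F] --> A -> g x @[x --> F] --> B ->
  f x *m g x @[x --> F] --> A *m B.
Proof.
move=> FF fA gB; apply: cvg_mx => i j; rewrite mxE.
under eq_fun do rewrite mxE.
by apply: cvg_big => [|k _]; [exact: add_continuous|apply: cvgM; exact: cvg_coord].
Qed.

Lemma cvg_trmx (R : realType) (T : Type) (F : set_system T) (m n : nat)
    (f : T -> 'M[R]_(m, n)) (A : 'M[R]_(m, n)) : Filter F ->
  f x @[x --> F] --> A -> (f x)^T @[x --> F] --> A^T.
Proof.
move=> FF fA; apply: cvg_mx => i j; rewrite mxE.
under eq_fun do rewrite mxE.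
exact: cvg_coord.
Qed.

Lemma cvg_det (R : realType) (T : Type) (F : set_system T) (n : nat)
    (f : T -> 'M[R]_n) (A : 'M[R]_n) : Filter F ->
  f x @[x --> F] --> A -> \det (f x) @[x --> F] --> \det A.
Proof.
move=> FF fA; apply: cvg_big => [|s _]; first exact: add_continuous.
apply: cvgM; first exact: cvg_cst.
by apply: cvg_big => [|i _]; [exact: mul_continuous|exact: cvg_coord].
Qed.

(** * Orthogonal matrices of order 3 along the sphere *)

Lemma det3 (R : comPzRingType) (M : 'M[R]_3) : \det M =
  M 0 0 * (M 1 1 * M 2 2 - M 1 2 * M 2 1)
  - M 0 1 * (M 1 0 * M 2 2 - M 1 2 * M 2 0)
  + M 0 2 * (M 1 0 * M 2 1 - M 1 1 * M 2 0).
Proof.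
pose m a b := M (inord a) (inord b).
have E i j : M i j = m i j by rewrite /m !inord_val.
rewrite (expand_det_row _ ord0) !big_ord_recl big_ord0 /cofactor.
rewrite !(expand_det_row _ ord0) !big_ord_recl !big_ord0 /cofactor !det_mx11.
rewrite !mxE !E /= /bump /=; ring.
Qed.

Lemma sum3 (R : nmodType) (f : 'I_3 -> R) : \sum_i f i = f 0 + f 1 + f 2.
Proof.
rewrite !big_ord_recl big_ord0 addr0 addrA; congr (f _ + f _ + f _); exact: val_inj.
Qed.

Lemma ord3P (P : 'I_3 -> Prop) : P 0 -> P 1 -> P 2 -> forall i, P i.
Proof.
move=> p0 p1 p2 [[|[|[|//]]] h].
- by have -> : Ordinal h = 0 by exact: val_inj.
- by have -> : Ordinal h = 1 by exact: val_inj.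
- by have -> : Ordinal h = 2 by exact: val_inj.
Qed.

(** The hypotheses on the upper left block say that the quadratic form of M has
    no trace-free part on the first two coordinates.  Orthogonality of the rows
    then forces the rest of the third row and column to vanish, so that M
    preserves the third axis; the sign there is the determinant because the
    upper left block is a rotation. *)
Lemma orth3_conformal (R : realType) (M : 'M[R]_3) : M *m M^T = 1%:M ->
  M 0 0 = M 1 1 -> M 0 1 = - M 1 0 ->
  [/\ M 2 0 = 0, M 2 1 = 0 & M 2 2 = \det M].
Proof.
move=> MM e1 e2.
have MM' : M^T *m M = 1%:M by apply: mulmx1C.
have r i j : M i 0 * M j 0 + M i 1 * M j 1 + M i 2 * M j 2 = (i == j)%:R.
  by move/matrixP: MM => /(_ i j); rewrite !mxE sum3 !mxE.
have c i j : M 0 i * M 0 j + M 1 i * M 1 j + M 2 i * M 2 j = (i == j)%:R.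
  by move/matrixP: MM' => /(_ i j); rewrite !mxE sum3 !mxE.
have r00 := r 0 0; have r11 := r 1 1; have r01 := r 0 1; have c22 := c 2 2.
have r22 := r 2 2; rewrite det3; move: r00 r11 r01 c22 r22.
rewrite !eqxx (_ : (0 == 1 :> 'I_3) = false)// mulr0n mulr1n.
rewrite e1 e2.
move: (M 1 0) (M 1 1) (M 0 2) (M 1 2) (M 2 0) (M 2 1) (M 2 2).
move=> p q x y a b z.
move=> r00 r11 r01 c22 r22.
have xy : x * y = 0 by lra.
have xx : x ^+ 2 = y ^+ 2 by rewrite !expr2; lra.
have x0 : x = 0.
  move/eqP: xy; rewrite mulf_eq0 => /orP[/eqP//|/eqP y0].
  by apply/eqP; rewrite -sqrf_eq0 xx y0 expr0n.
have y0 : y = 0 by apply/eqP; rewrite -sqrf_eq0 -xx x0 expr0n.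
have z1 : z * z = 1 by move: c22; rewrite x0 y0 !mul0r !add0r.
have ab : a ^+ 2 + b ^+ 2 = 0 by rewrite !expr2; lra.
have a0 : a = 0.
  by apply/eqP; rewrite -sqrf_eq0 eq_le sqr_ge0 andbT -ab lerDl sqr_ge0.
have b0 : b = 0.
  by apply/eqP; rewrite -sqrf_eq0 eq_le sqr_ge0 andbT -ab lerDr sqr_ge0.
split=> //; rewrite x0 y0 a0 b0.
have qp : q * q + p * p = 1 by move: r11; rewrite y0; lra.
by rewrite -[LHS]mulr1 -qp; ring.
Qed.

Lemma is_arg_exists (R : realType) (a b : R) : 0 < a ^+ 2 + b ^+ 2 ->
  exists t, is_arg a b t.
Proof.
move=> ab; case: (ltgtP a 0) => a0.
- have [] := @is_arg_atan R (- a) (- b); first by rewrite oppr_gt0.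
  move=> h1 h2; exists (atan (- b / - a) + pi).
  by rewrite /is_arg cosDpi sinDpi; split; lra.
- by exists (atan (b / a)); exact: is_arg_atan.
- move: ab; rewrite a0 expr0n add0r /= => b2.
  case: (ltgtP b 0) => b0.
  + by exists (- (pi / 2)); rewrite /is_arg cosN sinN cos_pihalf sin_pihalf; split; lra.
  + by exists (pi / 2); rewrite /is_arg cos_pihalf sin_pihalf; split; lra.
  + by rewrite b0 expr0n ltxx in b2.
Qed.

Lemma is_arg_rot (R : realType) (a b t s : R) : is_arg a b t ->
  is_arg (a * cos s + b * sin s) (b * cos s - a * sin s) (t - s).
Proof.
rewrite /is_arg cosB sinB; have := cos2Dsin2 s.
move: (cos t) (sin t) (cos s) (sin s) => c d c' d' cd [p e]; split.
  suff -> : (a * c' + b * d') * (c * c' + d * d') +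
    (b * c' - a * d') * (d * c' - c * d') =
    (a * c + b * d) * (c' ^+ 2 + d' ^+ 2) by rewrite cd mulr1.
  ring.
suff : (b * c' - a * d') * (c * c' + d * d') -
   (a * c' + b * d') * (d * c' - c * d') = (b * c - a * d) * (c' ^+ 2 + d' ^+ 2).
  by rewrite e subrr mul0r => /eqP; rewrite subr_eq0 => /eqP.
ring.
Qed.

(** The third row is the point of latitude p and longitude t on the unit sphere;
    the first two are the unit tangent vectors along the parallel and along the
    meridian. *)
Definition sphframe (R : realType) (p t : R) : 'M[R]_3 :=
  \matrix_(i, j) nth 0 (nth [::]
    [:: [:: - sin t; cos t; 0];
        [:: - (sin p * cos t); - (sin p * sin t); cos p];
        [:: cos p * cos t; cos p * sin t; sin p]] i) j.

Lemma sphframe_orth (R : realType) (p t : R) :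
  sphframe p t *m (sphframe p t)^T = 1%:M.
Proof.
have ep : cos p ^+ 2 = 1 - sin p ^+ 2 by rewrite -(cos2Dsin2 p) addrK.
have et : cos t ^+ 2 = 1 - sin t ^+ 2 by rewrite -(cos2Dsin2 t) addrK.
apply/matrixP; elim/ord3P; elim/ord3P; rewrite !mxE sum3 !mxE /= ?mulr1n ?mulr0n;
move: (cos p) (sin p) (cos t) (sin t) ep et => a b c d ep et; ring: ep et.
Qed.

Lemma continuous_sphframe (R : realType) (z : R * R) :
  sphframe z.1 z.2 @[z --> z] --> sphframe z.1 z.2.
Proof.
have c1 : cos y.1 @[y --> z] --> cos z.1.
  by apply: (@continuous_cvg _ _ _ _ _ fst cos); [exact: continuous_cos|exact: cvg_fst].
have s1 : sin y.1 @[y --> z] --> sin z.1.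
  by apply: (@continuous_cvg _ _ _ _ _ fst sin); [exact: continuous_sin|exact: cvg_fst].
have c2 : cos y.2 @[y --> z] --> cos z.2.
  by apply: (@continuous_cvg _ _ _ _ _ snd cos); [exact: continuous_cos|exact: cvg_snd].
have s2 : sin y.2 @[y --> z] --> sin z.2.
  by apply: (@continuous_cvg _ _ _ _ _ snd sin); [exact: continuous_sin|exact: cvg_snd].
apply: cvg_mx; elim/ord3P; elim/ord3P; rewrite !mxE /=;
  under eq_fun do rewrite !mxE /=;
  do ?[exact: cvg_cst | exact: cvgM | exact: cvgN | assumption | apply: cvgN].
Qed.

(** Take the trace-free part (a, b) of the quadratic form of rho c on the tangent
    plane at c, in the frame [sphframe].  A zero of (a, b) is the required point,
    by [orth3_conformal].  Without zeros, (a, b) has the same winding number on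
    all parallels.  At the pole rho c does not vary while the frame makes one
    turn, and a quadratic form turns twice as fast: the argument changes by
    - 4 pi.  On the equator the points t and t + pi are antipodal and share the
    same rho, while the vector along the parallel changes sign: (a, b) becomes
    (a, - b), so the argument of one half-turn undoes that of the other and the
    change is 0. *)
Lemma even_orthogonal_fixpoint (R : realType) (e : R) (rho : 'rV[R]_3 -> 'M[R]_3) :
  (forall c : 'rV[R]_3, c != 0 -> {for c, continuous rho}) ->
  (forall c : 'rV[R]_3, c != 0 -> rho c *m (rho c)^T = 1%:M) ->
  (forall c : 'rV[R]_3, c != 0 -> \det (rho c) = e) ->
  (forall c : 'rV[R]_3, c != 0 -> rho (- c) = rho c) ->
  exists2 c : 'rV[R]_3, c != 0 & c *m rho c = e *: c.
Proof.
move=> rc ro re rN; apply: contrapT => nex.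
pose c p t := row 2 (sphframe p t : 'M[R]_3).
have c0 p t : c p t != 0.
  apply/eqP => h; have /matrixP/(_ 2 2) := sphframe_orth p t.
  rewrite !mxE eqxx sum3 !mxE /= => h1.
  have hh j : sphframe p t 2 j = 0 by have /rowP/(_ j) := h; rewrite !mxE.
  have := hh 0; have := hh 1; have := hh 2; rewrite !mxE /= => e2 e1 e0.
  by move: h1; rewrite e0 e1 e2; lra.
pose N p t := sphframe p t *m rho (c p t) *m (sphframe p t)^T.
have No p t : N p t *m (N p t)^T = 1%:M.
  rewrite /N !trmx_mul trmxK !mulmxA.
  rewrite -(mulmxA (_ *m _) _ (sphframe p t)) (mulmx1C (sphframe_orth p t)) mulmx1.
  by rewrite -(mulmxA _ (rho _)) ro// mulmx1 sphframe_orth.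
have Nd p t : \det (N p t) = e.
  rewrite /N !det_mulmx re// mulrC mulrA -det_mulmx (mulmx1C (sphframe_orth p t)).
  by rewrite det1 mul1r.
pose a p t := N p t 0 0 - N p t 1 1.
pose b p t := N p t 0 1 + N p t 1 0.
have cN : forall z : R * R, N y.1 y.2 @[y --> z] --> N z.1 z.2.
  move=> z; apply: cvg_mulmx; last by apply: cvg_trmx; exact: continuous_sphframe.
  apply: cvg_mulmx; first exact: continuous_sphframe.
  apply: (@continuous_cvg _ _ _ _ _ (fun y : R * R => c y.1 y.2) rho); first exact: rc.
  apply: cvg_mx => i j; rewrite mxE; under eq_fun do rewrite mxE.
  by apply: cvg_coord; exact: continuous_sphframe.
have ca : continuous (fun z : R * R => a z.1 z.2).
  by move=> z; apply: cvgB; apply: cvg_coord; exact: cN.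
have cb : continuous (fun z : R * R => b z.1 z.2).
  by move=> z; apply: cvgD; apply: cvg_coord; exact: cN.
have sT p t : sphframe p (t + pi *+ 2) = sphframe p t :> 'M[R]_3.
  by apply/matrixP => i j; rewrite !mxE sinD2pi cosD2pi.
have NT p t : N p (t + pi *+ 2) = N p t by rewrite /N /c sT.
have ab p t : 0 < a p t ^+ 2 + b p t ^+ 2.
  rewrite lt_neqAle addr_ge0 ?sqr_ge0// andbT eq_sym paddr_eq0 ?sqr_ge0//.
  rewrite !sqrf_eq0 subr_eq0 addr_eq0; apply/negP => /andP[/eqP e1 /eqP e2].
  have [n0 n1 n2] := orth3_conformal (No p t) e1 e2.
  apply: nex; exists (c p t) => //.
  have rN2 : row 2 (N p t) = e *: row 2 1%:M.
    by apply/rowP; elim/ord3P; rewrite [LHS]mxE ?n0 ?n1 ?n2 ?Nd !mxE ?mulr0 ?mulr1.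
  have : row 2 (N p t) *m sphframe p t = c p t *m rho (c p t).
    rewrite -row_mul /N -!mulmxA (mulmx1C (sphframe_orth p t)) mulmx1.
    by rewrite row_mul.
  by rewrite rN2 -scalemxAl -row_mul mul1mx => <-.
(* At the pole c does not depend on t: rho c is a constant matrix m, expressed
   in a frame that rotates with t. *)
have wpole : winds (- (pi *+ 4)) (a (pi / 2)) (b (pi / 2)).
  have cp t : c (pi / 2) t = c (pi / 2) 0.
    by apply/rowP; elim/ord3P; rewrite !mxE /= ?cos_pihalf ?mul0r.
  pose m := rho (c (pi / 2) 0).
  pose x := m 1 1 - m 0 0; pose y := - (m 0 1 + m 1 0).
  have NE t : N (pi / 2) t = sphframe (pi / 2) t *m m *m (sphframe (pi / 2) t)^T.
    by rewrite /N cp.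
  have aE t : a (pi / 2) t = x * cos (t *+ 2) + y * sin (t *+ 2).
    rewrite /a NE !mxE !sum3 !mxE !sum3 !mxE /= sin_pihalf cos_pihalf /x /y.
    by rewrite !mulr2n cosD sinD; ring.
  have bE t : b (pi / 2) t = y * cos (t *+ 2) - x * sin (t *+ 2).
    rewrite /b NE !mxE !sum3 !mxE !sum3 !mxE /= sin_pihalf cos_pihalf /x /y.
    by rewrite !mulr2n cosD sinD; ring.
  have [w0 w0E] : exists t, is_arg x y t.
    apply: is_arg_exists; have := ab (pi / 2) 0; rewrite aE bE mul0rn.
    by rewrite cos0 sin0 !mulr1 !mulr0 addr0 subr0.
  exists (fun t => w0 - t *+ 2); split.
  - by move=> t; apply: cvgB; [exact: cvg_cst|apply: cvgMn; exact: cvg_id].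
  - by move=> t; rewrite aE bE; exact: is_arg_rot.
  - by move=> t; rewrite mulrnDl -mulrnA opprD addrA.
have aT p t : a p (t + pi *+ 2) = a p t by rewrite /a NT.
have bT p t : b p (t + pi *+ 2) = b p t by rewrite /b NT.
have [w [cw aw pw]] := winds_homotopy ca cb aT bT ab 0 wpole.
(* On the equator the frame at t + pi is the frame at t with its first and third
   vectors reversed. *)
pose D : 'M[R]_3 := diag_mx (\row_j (if j == 1 then 1 else -1)).
have sD t : sphframe 0 (t + pi) = D *m sphframe 0 t.
  by apply/matrixP; elim/ord3P; elim/ord3P;
    rewrite mul_diag_mx !mxE /= ?cosDpi ?sinDpi ?cos0 ?sin0; ring.
have ND t : N 0 (t + pi) = D *m N 0 t *m D.
  have -> : N 0 (t + pi) =
      sphframe 0 (t + pi) *m rho (c 0 t) *m (sphframe 0 (t + pi))^T.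
    rewrite /N (_ : c 0 (t + pi) = - c 0 t) ?rN//.
    by rewrite /c sD row_mul; apply/rowP => j; rewrite !mxE sum3 !mxE /= ; ring.
  by rewrite sD trmx_mul tr_diag_mx /N !mulmxA.
have aD t : a 0 (t + pi) = a 0 t.
  by rewrite /a ND mul_mx_diag mul_diag_mx !mxE /=; ring.
have bD t : b 0 (t + pi) = - b 0 t.
  by rewrite /b ND mul_mx_diag mul_diag_mx !mxE /=; ring.
have g1 t : cos (w t + w (t + pi)) = 1.
  by apply: is_arg_conj (aw t) _; rewrite -bD -aD; exact: aw.
have cg : continuous (fun t => w t + w (t + pi)).
  move=> t; apply: cvgD; first exact: cw.
  apply: (@continuous_cvg _ _ _ _ _ (fun t => t + pi) w); first exact: cw.
  by apply: cvgD; [exact: cvg_id|exact: cvg_cst].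
have := cos1_const cg g1 0 pi; rewrite /= add0r -mulr2n -[pi *+ 2]add0r pw.
by have := pi_gt0 R; lra.
Qed.

(** * The Euclidean product *)

Lemma dotvE (R : realType) n (u v : 'rV[R]_n) : dotv u v = (u *m v^T) 0 0.
Proof. by rewrite mxE; apply: eq_bigr => i _; rewrite mxE. Qed.

Lemma dotvC (R : realType) n (u v : 'rV[R]_n) : dotv u v = dotv v u.
Proof. by apply: eq_bigr => i _; rewrite mulrC. Qed.

Lemma dotvDl (R : realType) n (u v w : 'rV[R]_n) :
  dotv (u + v) w = dotv u w + dotv v w.
Proof. by rewrite !dotvE mulmxDl mxE. Qed.

Lemma dotvDr (R : realType) n (u v w : 'rV[R]_n) :
  dotv u (v + w) = dotv u v + dotv u w.
Proof. by rewrite dotvC dotvDl !(dotvC u). Qed.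

Lemma dotvZl (R : realType) n a (u v : 'rV[R]_n) :
  dotv (a *: u) v = a * dotv u v.
Proof. by rewrite !dotvE -scalemxAl mxE. Qed.

Lemma dotvZr (R : realType) n a (u v : 'rV[R]_n) :
  dotv u (a *: v) = a * dotv u v.
Proof. by rewrite dotvC dotvZl dotvC. Qed.

Lemma dotvNl (R : realType) n (u v : 'rV[R]_n) : dotv (- u) v = - dotv u v.
Proof. by rewrite -scaleN1r dotvZl mulN1r. Qed.

Lemma dotvNr (R : realType) n (u v : 'rV[R]_n) : dotv u (- v) = - dotv u v.
Proof. by rewrite dotvC dotvNl dotvC. Qed.

Lemma dotvBl (R : realType) n (u v w : 'rV[R]_n) :
  dotv (u - v) w = dotv u w - dotv v w.
Proof. by rewrite dotvDl dotvNl. Qed.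

Lemma dotvBr (R : realType) n (u v w : 'rV[R]_n) :
  dotv u (v - w) = dotv u v - dotv u w.
Proof. by rewrite dotvDr dotvNr. Qed.

Lemma dotv0r (R : realType) n (u : 'rV[R]_n) : dotv u 0 = 0.
Proof. by rewrite dotvE trmx0 mulmx0 mxE. Qed.

Lemma dotv0l (R : realType) n (u : 'rV[R]_n) : dotv 0 u = 0.
Proof. by rewrite dotvC dotv0r. Qed.

Lemma dotv_mull (R : realType) m n (u : 'rV[R]_m) (A : 'M[R]_(m, n)) v :
  dotv (u *m A) v = dotv u (v *m A^T).
Proof. by rewrite !dotvE trmx_mul trmxK mulmxA. Qed.

Lemma dotv_mulr (R : realType) m n (u : 'rV[R]_m) (A : 'M[R]_(m, n)) v :
  dotv v (u *m A) = dotv (v *m A^T) u.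
Proof. by rewrite dotvC dotv_mull dotvC. Qed.

Lemma dotv_ge0 (R : realType) n (u : 'rV[R]_n) : 0 <= dotv u u.
Proof. by apply: sumr_ge0 => i _; rewrite -expr2 sqr_ge0. Qed.

Lemma dotv_eq0 (R : realType) n (u : 'rV[R]_n) : (dotv u u == 0) = (u == 0).
Proof.
apply/eqP/eqP => [h|->]; last by rewrite dotv0r.
apply/rowP => i; rewrite mxE; apply/eqP; rewrite -sqrf_eq0 expr2.
by move/psumr_eq0P : h => ->// j _; rewrite -expr2 sqr_ge0.
Qed.

Lemma dotv_gt0 (R : realType) n (u : 'rV[R]_n) : (0 < dotv u u) = (u != 0).
Proof. by rewrite lt_neqAle dotv_ge0 andbT eq_sym dotv_eq0. Qed.

Lemma dotv_isom (R : realType) m n (A : 'M[R]_(m, n)) (u v : 'rV[R]_m) :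
  A *m A^T = 1%:M -> dotv (u *m A) (v *m A) = dotv u v.
Proof. by move=> AA; rewrite dotv_mull -mulmxA AA mulmx1. Qed.

Lemma cvg_dotv (R : realType) n (T : Type) (F : set_system T)
    (f g : T -> 'rV[R]_n) u v : Filter F ->
  f x @[x --> F] --> u -> g x @[x --> F] --> v ->
  dotv (f x) (g x) @[x --> F] --> dotv u v.
Proof.
move=> FF fu gv; apply: cvg_big => [|i _]; first exact: add_continuous.
by apply: cvgM; exact: cvg_coord.
Qed.

(** * Closed graphs and compactness *)

(** Compactness of K gives a cluster value y of r along H; then (w, y) adheres to
    the pairs (x, r x), which belong to C. *)
Lemma closed_graph_cluster (X Y : topologicalType) (H : set_system X) (w : X)
    (r : X -> Y) (C : set (X * Y)) (K : set Y) : ProperFilter H ->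
  H --> w -> closed C -> compact K ->
  (\forall x \near H, C (x, r x) /\ K (r x)) ->
  exists y, [/\ K y, C (w, y) & cluster (r @ H) y].
Proof.
move=> PH Hw clC cK near_CK.
have [|y [Ky cy]] := cK (r @ H) _.
  by apply: filterS near_CK => x [].
exists y; split => //; apply: clC => U [[V W] /= [Vw Wy] VWU].
have HVC : H [set x | V x /\ C (x, r x)].
  by apply: filterS (filterI near_CK (Hw _ Vw)) => x [[Cx _] Vx].
have HV : (r @ H) (r @` [set x | V x /\ C (x, r x)]).
  by apply: (@filterS _ H) HVC => x hx /=; exists x.
have [z [[x [Vx Cx] <-] Wz]] := cy _ W HV Wy.
by exists (x, r x); split => //; apply: VWU; split.
Qed.

(** Otherwise r would stay outside a neighbourhood of y0 along a proper filter
    converging to w; its cluster value given by [closed_graph_cluster] would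
    contradict uniqueness. *)
Lemma closed_graph_cvg (X Y : topologicalType) (w : X)
    (r : X -> Y) (C : set (X * Y)) (K : set Y) (y0 : Y) :
  closed C -> compact K ->
  (\forall x \near w, C (x, r x) /\ K (r x)) ->
  (forall y, K y -> C (w, y) -> y = y0) -> r x @[x --> w] --> y0.
Proof.
move=> clC cK near_CK uni V Vy0; apply: contrapT => nV.
pose B := [set x | ~ V (r x)].
have PB : ProperFilter (within B (nbhs w)).
  apply: Build_ProperFilter_ex => A.
  rewrite /within/= => hA; apply: contrapT => nA; apply: nV.
  apply: filterS hA => x /= hx; apply: contrapT => nv; apply: nA.
  by exists x; exact: hx.
have [||y [Ky Cy cy]] :=
    @closed_graph_cluster _ _ (within B (nbhs w)) w r C K PB _ clC cK _.
- exact: cvg_within.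
- by apply: cvg_within near_CK.
have ey := uni y Ky Cy.
have [||z [/= nz Vz]] := cy (~` V) V _ _; last exact: nz.
- by apply: filterS (withinT B (nbhs_filter w)).
- by rewrite ey.
Qed.

Lemma compact_mx (R : realType) m n (M : R) :
  compact [set A : 'M[R]_(m, n) | forall i j, `|A i j| <= M].
Proof.
have cK : compact [set v : 'rV[R]_(m * n) | forall i, `[- M, M]%classic (v ord0 i)].
  by apply: (@rV_compact R _ (fun=> `[- M, M]%classic)) => i; exact: segment_compact.
have -> : [set A : 'M[R]_(m, n) | forall i j, `|A i j| <= M] =
  vec_mx @` [set v : 'rV[R]_(m * n) | forall i, `[- M, M]%classic (v ord0 i)].
  apply/seteqP; split => [A h|_ [v h <-] i j].
    exists (mxvec A); last exact: mxvecK.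
    by move=> k; case/mxvec_indexP: k => i j /=; rewrite mxvecE in_itv/= -ler_norml.
  by rewrite mxE ler_norml; have := h (mxvec_index i j); rewrite /= in_itv.
apply: continuous_compact cK; apply: continuous_subspaceT => v.
apply: (@cvg_mx _ _ (nbhs v) _ _ _ _ (nbhs_filter v)) => i j; rewrite mxE.
under eq_fun do rewrite mxE.
exact: coord_continuous.
Qed.

Lemma closed_eqr (R : realType) (X : topologicalType) (f g : X -> R) :
  continuous f -> continuous g -> closed [set x | f x = g x].
Proof.
move=> cf cg; have -> : [set x | f x = g x] = (fun x => f x - g x) @^-1` [set 0].
  by apply/seteqP; split=> x /= /eqP h; apply/eqP; rewrite subr_eq0 in h *.
apply: closed_comp => [x _|]; last exact: closed_eq.
by apply: cvgB; [exact: cf|exact: cg].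
Qed.

Lemma closed_eqmx (R : realType) (X : topologicalType) m n
    (f g : X -> 'M[R]_(m, n)) :
  continuous f -> continuous g -> closed [set x | f x = g x].
Proof.
move=> cf cg; have -> : [set x | f x = g x] =
    \bigcap_(k : 'I_m * 'I_n) [set x | f x k.1 k.2 = g x k.1 k.2].
  apply/seteqP; split=> x /= h; first by move=> k _; rewrite /= h.
  by apply/matrixP => i j; exact: (h (i, j)).
apply: closed_bigI => k _; apply: closed_eqr => x; apply: cvg_coord.
  exact: cf.
exact: cg.
Qed.

Lemma orth_compact (R : realType) n : compact [set A : 'M[R]_n | A *m A^T = 1%:M].
Proof.
apply: (subclosed_compact _ (@compact_mx R n n 1)) => [|A AA i j /=].
  apply: (@closed_eqmx _ 'M[R]_n _ _ (fun A => A *m A^T) (fun=> 1%:M)) => A;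
    last by apply: (cvg_cst (1%:M : 'M[R]_n)); exact: nbhs_filter.
  apply: (@cvg_mulmx R _ (nbhs A) n n n id (@trmx R n n) A A^T (nbhs_filter A)).
    exact: cvg_id.
  by apply: (@cvg_trmx R _ (nbhs A) n n id A (nbhs_filter A)); exact: cvg_id.
have : \sum_k A i k ^+ 2 = 1.
  move/matrixP: AA => /(_ i i); rewrite !mxE eqxx => AAi.
  by rewrite -[RHS]AAi; apply: eq_bigr => k _; rewrite mxE.
rewrite (bigD1 j)//= => h.
have s0 : 0 <= \sum_(k < n | k != j) A i k ^+ 2.
  by apply: sumr_ge0 => k _; exact: sqr_ge0.
rewrite -(@ler_pXn2r _ 2)// ?nnegrE// expr1n real_normK ?num_real//; lra.
Qed.

(** * Hyperplanes of the quaternions *)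

(** The rows are the quaternion products i w, j w and k w, where w stands for
    the quaternion with these four coordinates. *)
Definition qframe (R : realType) (w : 'rV[R]_4) : 'M[R]_(3, 4) :=
  let a := w 0 0 in let b := w 0 1 in let c := w 0 2 in let d := w 0 3 in
  \matrix_(i, j) nth 0 (nth [::] [:: [:: - b; a; - d; c];
                                     [:: - c; d; a; - b];
                                     [:: - d; - c; b; a]] i) j.

Lemma sum4 (R : nmodType) (f : 'I_4 -> R) : \sum_i f i = f 0 + f 1 + f 2 + f 3.
Proof.
rewrite !big_ord_recl big_ord0 addr0 !addrA.
by congr (f _ + f _ + f _ + f _); exact: val_inj.
Qed.

Lemma ord4P (P : 'I_4 -> Prop) : P 0 -> P 1 -> P 2 -> P 3 -> forall i, P i.
Proof.
move=> p0 p1 p2 p3 [[|[|[|[|//]]]] h].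
- by have -> : Ordinal h = 0 by exact: val_inj.
- by have -> : Ordinal h = 1 by exact: val_inj.
- by have -> : Ordinal h = 2 by exact: val_inj.
- by have -> : Ordinal h = 3 by exact: val_inj.
Qed.

Lemma qframe_orth (R : realType) (w : 'rV[R]_4) :
  qframe w *m (qframe w)^T = (dotv w w)%:M.
Proof.
by apply/matrixP; elim/ord3P; elim/ord3P;
  rewrite !mxE /dotv !sum4 !mxE /= ?mulr1n ?mulr0n; ring.
Qed.

Lemma qframe_perp (R : realType) (w : 'rV[R]_4) : qframe w *m w^T = 0.
Proof.
by apply/matrixP; elim/ord3P => j; rewrite ord1 !mxE !sum4 !mxE /=; ring.
Qed.

Lemma qframeZ (R : realType) (k : R) (w : 'rV[R]_4) :
  qframe (k *: w) = k *: qframe w.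
Proof. by apply/matrixP; elim/ord3P; elim/ord4P; rewrite !mxE /= ?mulrN. Qed.

(** For a purely imaginary quaternion c this is c (c u) = - |c|^2 u.  Thus u lies
    in the hyperplane orthogonal to w = c u, where its coordinates in the frame
    of w are proportional to c: the hyperplanes through u are parametrized by the
    sphere of the c's. *)
Lemma qframe_qframe (R : realType) (c : 'rV[R]_3) (u : 'rV[R]_4) :
  c *m qframe (c *m qframe u) = - dotv c c *: u.
Proof.
apply/rowP; elim/ord4P;
rewrite /dotv !mxE !sum3 !mxE /= ?sum3 ?mxE /=; ring.
Qed.

Lemma cvg_qframe (R : realType) (w : 'rV[R]_4) : qframe v @[v --> w] --> qframe w.
Proof.
have cw i : v 0 i @[v --> w] --> w 0 i by exact: coord_continuous.
apply: (@cvg_mx R _ (nbhs w) _ _ _ _ (nbhs_filter w)).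
elim/ord3P; elim/ord4P; rewrite !mxE /=;
  under eq_fun do rewrite !mxE /=;
  first [exact: cw | by apply: (@cvgN _ _ _ (nbhs w) (nbhs_filter w)); exact: cw].
Qed.

Lemma qframe_mul_neq0 (R : realType) (c : 'rV[R]_3) (u : 'rV[R]_4) :
  c != 0 -> u != 0 -> c *m qframe u != 0.
Proof.
move=> c0 u0; rewrite -dotv_gt0 dotv_mull -mulmxA qframe_orth mul_mx_scalar.
by rewrite dotvZr mulr_gt0 ?dotv_gt0.
Qed.

Lemma qframe_span (R : realType) (y : 'rV[R]_4) :
  exists2 w, w != 0 & exists x, y = x *m qframe w.
Proof.
have [->|y0] := eqVneq y 0.
  exists (const_mx 1); last by exists 0; rewrite mul0mx.
  by apply/eqP => /rowP/(_ 0); rewrite !mxE => /eqP; rewrite oner_eq0.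
pose c : 'rV[R]_3 := const_mx 1.
have c0 : c != 0 by apply/eqP => /rowP/(_ 0); rewrite !mxE => /eqP; rewrite oner_eq0.
exists (c *m qframe y); first exact: qframe_mul_neq0.
exists ((- (dotv c c)^-1) *: c); rewrite -scalemxAl qframe_qframe scalerA.
by rewrite mulrNN mulVf ?scale1r// dotv_eq0.
Qed.

(** * Functions congruent on all hyperplanes *)

Lemma near_neq0 (R : realType) n (w : 'rV[R]_n) :
  w != 0 -> \forall v \near w, v != 0.
Proof.
move=> w0; have : dotv v v @[v --> w] --> dotv w w.
  by apply: (@cvg_dotv R n _ (nbhs w) id id w w (nbhs_filter w)); exact: cvg_id.
move=> /cvgr_gt/(_ 0); rewrite dotv_gt0 => /(_ w0).
by apply: filterS => v; rewrite dotv_gt0.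
Qed.

(** The segment joining two vectors avoids the origin unless they are
    proportional, and in that case the values agree by homogeneity. *)
Lemma sign_homogeneous_const (R : realType) n (g : 'rV[R]_n -> R) :
  (forall w : 'rV[R]_n, w != 0 -> g v @[v --> w] --> g w) ->
  (forall w : 'rV[R]_n, w != 0 -> g w = 1 \/ g w = -1) ->
  (forall k (w : 'rV[R]_n), k != 0 -> w != 0 -> g (k *: w) = g w) ->
  forall w1 w2 : 'rV[R]_n, w1 != 0 -> w2 != 0 -> g w1 = g w2.
Proof.
move=> gc g1 gZ w1 w2 w10 w20; pose f (t : R) := (1 - t) *: w1 + t *: w2.
have f0 : f 0 = w1 by rewrite /f subr0 scale1r scale0r addr0.
have f1 : f 1 = w2 by rewrite /f subrr scale1r scale0r add0r.
have [fn|/existsNP[t /not_implyP[_ /negP/negPn/eqP tz]]] :=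
    pselect (forall t : R, 0 <= t <= 1 -> f t != 0).
  have cg : {within `[0, 1], continuous (g \o f)}.
    apply: continuous_in_subspaceT => t; rewrite inE/= in_itv/= => t01.
    apply: (@continuous_cvg _ _ _ _ _ f g); first exact: gc (fn t t01).
    apply: cvgD; apply: cvgZr_tmp; last exact: cvg_id.
    by apply: cvgB; [exact: cvg_cst|exact: cvg_id].
  have no0 t : 0 <= t <= 1 -> g (f t) != 0.
    by move=> /fn /g1[] ->; rewrite ?oppr_eq0 oner_eq0.
  apply: contrapT => ne.
  have [|t] := @IVT R _ 0 1 0 ler01 cg; last first.
    by rewrite in_itv/= => /no0 /eqP.
  rewrite /= f0 f1 ge_min le_max; move: ne.
  by case: (g1 w1 w10) => ->; case: (g1 w2 w20) => -> // _;
    rewrite ?lerN10 ?ler01 ?orbT.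
have t0 : t != 0.
  by apply: contraNneq w10 => t0; move: tz; rewrite t0 f0 => ->.
have t1 : 1 - t != 0.
  apply: contraNneq w20 => t1; move: tz; rewrite /f t1 scale0r add0r => /eqP.
  by rewrite scaler_eq0 (negbTE t0).
have -> : w1 = (- (t / (1 - t))) *: w2.
  apply: (scalerI t1); rewrite scalerA mulrN mulrCA divff// mulr1 scaleNr.
  by apply/eqP; rewrite -addr_eq0 -/(f t) tz.
by rewrite gZ// oppr_eq0 mulf_neq0 ?invr_eq0.
Qed.

(** The last hypothesis makes rho unique, so compactness of the orthogonal group
    gives a rho for every w <> 0, not only in D, that depends continuously on w;
    its determinant e is then constant.  For u <> 0 the map sending c to the rho
    of w = c u is even because w and - w have the same orthogonal hyperplane, so
    [even_orthogonal_fixpoint] yields a hyperplane containing u whose rho maps u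
    to e u.  Hence F 0 u = G 0 (e u) for every u, and uniqueness
    gives rho = e everywhere. *)
Lemma signed_congruence (R : realType) (F G : R -> 'rV[R]_4 -> R) (D : set 'rV[R]_4) :
  continuous (fun z : R * 'rV[R]_4 => F z.1 z.2) ->
  continuous (fun z : R * 'rV[R]_4 => G z.1 z.2) ->
  (forall w : 'rV[R]_4, w != 0 -> closure D w) ->
  (forall w, D w -> exists2 rho : 'M[R]_3, rho *m rho^T = 1%:M &
     forall s x, F s (x *m qframe w) = G (\det rho * s) (x *m rho *m qframe w)) ->
  (forall w : 'rV[R]_4, w != 0 -> forall rho : 'M[R]_3, rho *m rho^T = 1%:M ->
     (forall x, F 0 (x *m qframe w) = F 0 (x *m rho *m qframe w)) -> rho = 1%:M) ->
  exists2 e : R, e = 1 \/ e = -1 & forall s y, F s y = G (e * s) (e *: y).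
Proof.
move=> cF cG dD exD uni.
pose C := [set z : 'rV[R]_4 * 'M[R]_3 | forall s x,
  F s (x *m qframe z.1) = G (\det z.2 * s) (x *m z.2 *m qframe z.1)].
pose K := [set rho : 'M[R]_3 | rho *m rho^T = 1%:M].
have cK : compact K by exact: orth_compact.
have clC : closed C.
  have -> : C = \bigcap_(k : R * 'rV[R]_3)
      [set z : 'rV[R]_4 * 'M[R]_3 | F k.1 (k.2 *m qframe z.1) =
        G (\det z.2 * k.1) (k.2 *m z.2 *m qframe z.1)].
    apply/seteqP; split=> z h; first by move=> k _; exact: h.
    by move=> s x; exact: (h (s, x)).
  apply: closed_bigI => -[s x] _; apply: closed_eqr => z /=.
    apply: (@continuous2_cvg _ _ _ _ _ _ (fun=> s)
      (fun z : 'rV[R]_4 * 'M[R]_3 => x *m qframe z.1) F s _ (cF (s, _))).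
      exact: cvg_cst.
    apply: cvg_mulmx; first exact: cvg_cst.
    apply: (@continuous_cvg _ _ _ _ _ fst (@qframe R)); first exact: cvg_qframe.
    exact: cvg_fst.
  apply: (@continuous2_cvg _ _ _ _ _ _
    (fun z : 'rV[R]_4 * 'M[R]_3 => \det z.2 * s)
    (fun z : 'rV[R]_4 * 'M[R]_3 => x *m z.2 *m qframe z.1) G _ _ (cG (_, _))).
    by apply: cvgM; [apply: cvg_det; exact: cvg_snd|exact: cvg_cst].
  apply: cvg_mulmx.
    by apply: cvg_mulmx; [exact: cvg_cst|exact: cvg_snd].
  apply: (@continuous_cvg _ _ _ _ _ fst (@qframe R)); first exact: cvg_qframe.
  exact: cvg_fst.
have exA (w : 'rV[R]_4) : w != 0 -> exists2 rho, K rho & C (w, rho).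
  move=> w0.
  have /choice[r rP] : forall v : 'rV[R]_4, exists rho : 'M[R]_3,
      D v -> K rho /\ C (v, rho).
    move=> v; have [Dv|nD] := pselect (D v); last by exists 1%:M.
    by have [rho Kr Cr] := exD v Dv; exists rho.
  have PD : ProperFilter (within D (nbhs w)) by apply: within_nbhs_proper; exact: dD.
  have [||rho [Kr Cr _]] :=
    @closed_graph_cluster _ _ (within D (nbhs w)) w r C K PD _ clC cK _.
  - exact: cvg_within.
  - by apply: filterS (withinT D (nbhs_filter w)) => v /rP[].
  - by exists rho.
have uniC (w : 'rV[R]_4) (r1 r2 : 'M[R]_3) : w != 0 ->
    K r1 -> K r2 -> C (w, r1) -> C (w, r2) -> r1 = r2.
  move=> w0 K1 K2 C1 C2.
  have K2' : r2^T *m r2 = 1%:M by exact: mulmx1C.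
  have h : r1 *m r2^T = 1%:M.
    apply: (uni w) => // [|x].
      by rewrite trmx_mul trmxK mulmxA -(mulmxA r1) K2' mulmx1.
    rewrite (C1 0 x) (C2 0 (x *m _)) /= !mulr0 !mulmxA.
    by rewrite -(mulmxA (x *m r1)) K2' mulmx1.
  by rewrite -[r1]mulmx1 -K2' mulmxA h mul1mx.
have /choice[r rP] : forall w : 'rV[R]_4, exists rho : 'M[R]_3,
    w != 0 -> K rho /\ C (w, rho).
  move=> w; have [->|w0] := eqVneq w 0; first by exists 1%:M.
  by have [rho Kr Cr] := exA w w0; exists rho.
have rK (w : 'rV[R]_4) : w != 0 -> K (r w) by move=> /rP[].
have rC (w : 'rV[R]_4) : w != 0 -> C (w, r w) by move=> /rP[].
have rc (w : 'rV[R]_4) : w != 0 -> r v @[v --> w] --> r w.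
  move=> w0; apply: (closed_graph_cvg clC cK) => [|y Ky Cy].
    by apply: filterS (near_neq0 w0) => v v0; split; [exact: rC|exact: rK].
  by apply: (uniC w) => //; [exact: rK|exact: rC].
have rZ k (w : 'rV[R]_4) : k != 0 -> w != 0 -> r (k *: w) = r w.
  move=> k0 w0; have kw0 : k *: w != 0 by rewrite scaler_eq0 negb_or k0.
  apply: (uniC (k *: w)) => //; [exact: rK|exact: rK|exact: rC|].
  move=> s x /=; rewrite qframeZ -!scalemxAr !scalemxAl.
  exact: (rC w w0 s (k *: x)).
have det_pm (w : 'rV[R]_4) : w != 0 -> \det (r w) = 1 \/ \det (r w) = -1.
  move=> /rK Kr; have : \det (r w) ^+ 2 = 1.
    by rewrite expr2 -{2}(det_tr (r w)) -det_mulmx Kr det1.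
  by move/eqP; rewrite sqrf_eq1 => /orP[] /eqP; [left|right].
have det_cst (w1 w2 : 'rV[R]_4) : w1 != 0 -> w2 != 0 -> \det (r w1) = \det (r w2).
  apply: (sign_homogeneous_const (g := fun w => \det (r w))) => //.
    by move=> w w0; apply: (@cvg_det R _ (nbhs w) 3 r _ (nbhs_filter w)); exact: rc.
  by move=> k w k0 w0; rewrite rZ.
have w0n : (const_mx 1 : 'rV[R]_4) != 0.
  by apply/eqP => /rowP/(_ 0); rewrite !mxE => /eqP; rewrite oner_eq0.
pose e := \det (r (const_mx 1)).
have e_pm : e = 1 \/ e = -1 by exact: det_pm.
have ee : e * e = 1 by case: e_pm => ->; rewrite ?mulr1 ?mulrNN ?mulr1.
have rd (w : 'rV[R]_4) : w != 0 -> \det (r w) = e by move=> ?; exact: det_cst.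
have F0 (u : 'rV[R]_4) : F 0 u = G 0 (e *: u).
  have [->|u0] := eqVneq u 0.
    by have := rC _ w0n 0 0; rewrite /= !mul0mx mulr0 scaler0.
  have [||||c c0 cr] :=
      @even_orthogonal_fixpoint R e (fun c : 'rV[R]_3 => r (c *m qframe u)).
  - move=> c c0; apply: (@continuous_cvg _ 'rV[R]_4 _ (nbhs c) (nbhs_filter c)
      (fun c : 'rV[R]_3 => c *m qframe u) r (c *m qframe u)).
      exact: (rc _ (qframe_mul_neq0 c0 u0)).
    apply: (@cvg_mulmx R _ (nbhs c) _ _ _ id (fun=> qframe u) c _ (nbhs_filter c)).
      exact: cvg_id.
    exact: cvg_cst.
  - by move=> c c0; apply: rK; exact: qframe_mul_neq0.
  - by move=> c c0; apply: rd; exact: qframe_mul_neq0.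
  - move=> c c0; rewrite mulNmx -scaleN1r rZ ?oppr_eq0 ?oner_eq0//.
    exact: qframe_mul_neq0.
  pose x := (- (dotv c c)^-1) *: c.
  have xu : x *m qframe (c *m qframe u) = u.
    rewrite -scalemxAl qframe_qframe scalerA mulrNN mulVf ?scale1r//.
    by rewrite dotv_eq0.
  have := rC _ (qframe_mul_neq0 c0 u0) 0 x; rewrite /= mulr0 xu => ->.
  by rewrite -[x *m _]scalemxAl cr scalerA mulrC -scalerA -scalemxAl xu.
have rE (w : 'rV[R]_4) : w != 0 -> r w = e%:M.
  move=> w0; have : e *: r w = 1%:M.
    apply: (uni w w0) => [|x].
      by rewrite linearZ /= -scalemxAl -scalemxAr scalerA ee scale1r rK.
    rewrite (rC w w0 0 x) /= mulr0 F0 -scalemxAr -scalemxAl scalerA ee scale1r//.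
  by move=> h; rewrite -[r w]scale1r -ee -scalerA h scalemx1.
exists e => // s y; have [w w0 [x ->]] := qframe_span y.
by rewrite (rC w w0 s x) /= rd// rE// mul_mx_scalar scalemxAl.
Qed.

(** * Support functions *)

Definition convex_compact (R : realType) n (K : set 'rV[R]_n) : Prop :=
  [/\ compact K, K !=set0 & forall x y (t : R), K x -> K y -> 0 <= t <= 1 ->
    K (t *: x + (1 - t) *: y)].

Lemma convex_body_compact (R : realType) n (K : set 'rV[R]_n) :
  convex_body K -> convex_compact K.
Proof.
move=> [[cK [x Kx] _] cvK]; split=> //; first by exists x; exact: interior_subset Kx.
move=> y z t Ky Kz t01.
have := cvK y z (Itv01 (proj1 (andP t01)) (proj2 (andP t01))).
by rewrite !inE; apply.
Qed.

Lemma dotv_max (R : realType) n (K : set 'rV[R]_n) (x : 'rV[R]_n) :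
  convex_compact K -> exists2 y, K y & forall z, K z -> dotv x z <= dotv x y.
Proof.
move=> [cK K0 _].
have cf : {within K, continuous (dotv x)}.
  apply: continuous_subspaceT => y.
  apply: (@cvg_dotv R n _ (nbhs y) (fun=> x) id _ _ (nbhs_filter y)).
    exact: cvg_cst.
  exact: cvg_id.
have [y] := compact_EVT_max K0 cK cf.
rewrite inE => Ky h; exists y => // z Kz; apply: h; exact: mem_set.
Qed.

Lemma support_funP (R : realType) n (K : set 'rV[R]_n) (x : 'rV[R]_n) :
  convex_compact K ->
  (exists2 y, K y & support_fun K x = dotv x y) /\
  (forall y, K y -> dotv x y <= support_fun K x).
Proof.
move=> cK; have [y Ky ymax] := dotv_max x cK.
suff e : support_fun K x = dotv x y.
  by split; [exists y|move=> z /ymax; rewrite e].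
apply/eqP; rewrite eq_le; apply/andP; split.
  apply: ge_sup; first by exists (dotv x y); exists y.
  by move=> _ [z Kz <-]; exact: ymax.
apply: ub_le_sup; last by exists y.
by exists (dotv x y) => _ [z Kz <-]; exact: ymax.
Qed.

Lemma support_ge (R : realType) n (K : set 'rV[R]_n) (x y : 'rV[R]_n) :
  convex_compact K -> K y -> dotv x y <= support_fun K x.
Proof. by move=> cK; have [_] := support_funP x cK; apply. Qed.

Lemma support_le (R : realType) n (K : set 'rV[R]_n) (x : 'rV[R]_n) (m : R) :
  convex_compact K -> (forall y, K y -> dotv x y <= m) -> support_fun K x <= m.
Proof. by move=> cK h; have [[y Ky ->] _] := support_funP x cK; exact: h. Qed.

Lemma supportZ (R : realType) n (K : set 'rV[R]_n) (x : 'rV[R]_n) (t : R) :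
  convex_compact K -> 0 <= t -> support_fun K (t *: x) = t * support_fun K x.
Proof.
move=> cK t0; apply/eqP; rewrite eq_le; apply/andP; split.
  by apply: support_le => // y Ky; rewrite dotvZl ler_wpM2l// support_ge.
have [[y Ky ->] _] := support_funP x cK.
by rewrite -dotvZl support_ge.
Qed.

Lemma support_continuous (R : realType) n (K : set 'rV[R]_n) :
  convex_compact K -> continuous (support_fun K).
Proof.
move=> cK x; pose phi (y : 'rV[R]_n) := \sum_i `|y 0 i|.
have cphi : continuous phi.
  apply: continuous_big => [|i _ y]; first exact: add_continuous.
  apply: (@continuous_cvg _ _ _ (nbhs y) (nbhs_filter y) (fun y : 'rV[R]_n => y 0 i)
    (fun r : R => `|r|)); first exact: norm_continuous.
  exact: coord_continuous.
have [M Mb] : exists M, forall y, K y -> phi y <= M.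
  have [ck K0 _] := cK.
  have [y _ h] := compact_EVT_max K0 ck (continuous_subspaceT cphi).
  by exists (phi y) => z Kz; apply: h; exact: mem_set.
have phi0 y : 0 <= phi y by apply: sumr_ge0.
have dM (y z : 'rV[R]_n) : K z -> dotv y z <= phi y * M.
  move=> Kz; apply: (@le_trans _ _ (phi y * phi z)); last first.
    by rewrite ler_wpM2l// Mb.
  rewrite /dotv /phi mulr_suml; apply: ler_sum => i _.
  apply: le_trans (ler_norm _) _; rewrite normrM ler_wpM2l//.
  by rewrite (bigD1 i)//= lerDl sumr_ge0.
have key y z : support_fun K y - phi (y - z) * M <= support_fun K z.
  rewrite lerBlDr; apply: support_le => // k Kk.
  rewrite -[y in dotv y](subrK z) dotvDl addrC lerD ?dM//.
  exact: support_ge.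
have phiN y z : phi (y - z) = phi (z - y).
  by apply: eq_bigr => i _; rewrite !mxE distrC.
have c0 : phi (y - x) * M @[y --> x] --> 0.
  rewrite -[X in _ --> X](mul0r M); apply: (@cvgM _ _ (nbhs x) (nbhs_filter x));
    last exact: (@cvg_cst R M _ (nbhs x) (nbhs_filter x)).
  rewrite (_ : 0 = phi (x - x)); last first.
    by rewrite subrr /phi big1// => i _; rewrite mxE normr0.
  apply: (@continuous_cvg _ _ _ (nbhs x) (nbhs_filter x) 
    (fun y => y - x) phi (x - x)).
    exact: cphi.
  apply: (@cvgB _ 'rV[R]_n _ (nbhs x) (nbhs_filter x) id (fun=> x) x x);
    first exact: cvg_id.
  exact: cvg_cst.
apply: (@squeeze_cvgr _ (nbhs x) (nbhs_filter x) R
   (fun y => support_fun K x - phi (y - x) * M)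
   (fun y => support_fun K x + phi (y - x) * M) (support_fun K)).
- apply: nearW => y; rewrite {1}phiN key /=.
  by rewrite -lerBlDr key.
- rewrite -[X in _ --> X]subr0; apply: (@cvgB _ R _ (nbhs x) (nbhs_filter x)) => //.
  exact: (@cvg_cst R _ _ (nbhs x) (nbhs_filter x)).
- rewrite -[X in _ --> X]addr0; apply: (@cvgD _ R _ (nbhs x) (nbhs_filter x)) => //.
  exact: (@cvg_cst R _ _ (nbhs x) (nbhs_filter x)).
Qed.

Lemma dotv_sqrB (R : realType) n (v w : 'rV[R]_n) (t : R) :
  dotv (v - t *: w) (v - t *: w) = dotv v v - 2 * t * dotv v w + t ^+ 2 * dotv w w.
Proof. by rewrite dotvBl !dotvBr !dotvZl !dotvZr (dotvC w v); ring. Qed.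

(** Let y be the point of K nearest to x.  Moving from y towards a point of K
    does not decrease the distance to x, so x - y is an outer normal of K at y;
    it would separate x from K if it were not zero. *)
Lemma support_separation (R : realType) n (K : set 'rV[R]_n) (x : 'rV[R]_n) :
  convex_compact K -> (forall v, dotv v x <= support_fun K v) -> K x.
Proof.
move=> cK h; have [ck K0 cvK] := cK.
pose d (y : 'rV[R]_n) := dotv (x - y) (x - y).
have cd : continuous d.
  move=> y; apply: (@cvg_dotv R n _ (nbhs y) (fun y => x - y) (fun y => x - y)
    _ _ (nbhs_filter y));
  apply: (@cvgB _ 'rV[R]_n _ (nbhs y) (nbhs_filter y) (fun=> x) id x y);
  by [exact: cvg_id|exact: cvg_cst].
have [y] := compact_EVT_min K0 ck (continuous_subspaceT cd).
rewrite inE => Ky ymin; pose v := x - y.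
suff : v = 0 by move/eqP; rewrite subr_eq0 => /eqP ->.
apply/eqP; rewrite -dotv_eq0 eq_le dotv_ge0 andbT.
suff vk z : K z -> dotv v z <= dotv v y.
  by have := le_trans (h v) (support_le cK vk); rewrite -subr_le0 -dotvBr.
move=> Kz; rewrite -subr_le0 -dotvBr leNgt; apply/negP => a0.
set a := dotv v (z - y) in a0.
pose b := dotv (z - y) (z - y).
have b0 : 0 <= b by exact: dotv_ge0.
have ab0 : 0 < a + b by rewrite ltr_wpDr.
(* The distance decreases for t < 2 a / b; with a added to the denominator, t
   stays in the unit interval and b = 0 is harmless. *)
pose t := a / (a + b).
have t01 : 0 <= t <= 1.
  by rewrite divr_ge0 ?(ltW a0) ?(ltW ab0)//= ler_pdivrMr// mul1r lerDl.
have := ymin (t *: z + (1 - t) *: y) (mem_set (cvK z y t Kz Ky t01)).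
have -> : d (t *: z + (1 - t) *: y) = d y - 2 * t * a + t ^+ 2 * b.
  rewrite /d /a /b.
  have -> : x - (t *: z + (1 - t) *: y) = v - t *: (z - y).
    by rewrite /v scalerBl scale1r scalerBr; apply/rowP => i; rewrite !mxE; ring.
  exact: dotv_sqrB.
have tE : t * (a + b) = a by rewrite /t divfK// gt_eqF.
have t0 : 0 < t by rewrite divr_gt0.
move=> H; suff : t * (t * b - 2 * a) < 0 by lra.
rewrite pmulr_rlt0//; have : t * b <= a.
  by rewrite -[X in _ <= X]tE mulrDr lerDr mulr_ge0// ltW.
lra.
Qed.

(** * Isometries of a subspace in orthonormal coordinates *)

Definition rowspan (R : realType) k n (X : 'M[R]_(k, n)) : {vspace 'rV[R]_n} :=
  limg (linfun (mulmxr X : 'rV[R]_k -> 'rV[R]_n)).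

Lemma mem_rowspan (R : realType) k n (X : 'M[R]_(k, n)) (y : 'rV[R]_k) :
  y *m X \in rowspan X.
Proof.
by apply/memv_imgP; exists y; rewrite ?memvf// lfunE.
Qed.

Lemma rowspanP (R : realType) k n (X : 'M[R]_(k, n)) (v : 'rV[R]_n) :
  X *m X^T = 1%:M -> v \in rowspan X -> v *m X^T *m X = v.
Proof.
by move=> XX /memv_imgP[y _ ->]; rewrite lfunE /= -(mulmxA y) XX mulmx1.
Qed.

Lemma dim_rowspan (R : realType) k n (X : 'M[R]_(k, n)) :
  X *m X^T = 1%:M -> \dim (rowspan X) = k.
Proof.
move=> XX; rewrite limg_dim_eq; first by rewrite dimvf /dim /= mul1n.
apply/eqP; rewrite -subv0; apply/subvP => y; rewrite memv_cap memv_ker lfunE /=.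
move=> /andP[_ /eqP yX]; rewrite memv0; apply/eqP.
by rewrite -[y]mulmx1 -XX mulmxA yX mul0mx.
Qed.

(** P is in fact square, but m and k are distinct terms in the use below, where
    one of them is the dimension of an abstract space. *)
Lemma det_intertwine (R : fieldType) m k (M : 'M[R]_m) (N : 'M[R]_k)
    (P : 'M[R]_(m, k)) (Q : 'M[R]_(k, m)) :
  P *m Q = 1%:M -> Q *m P = 1%:M -> M *m P = P *m N -> \det M = \det N.
Proof.
move=> PQ QP; have mk : m = k.
  by apply/eqP; rewrite eqn_leq (mulmx1_min PQ) (mulmx1_min QP).
subst m => MP; have dP : \det P != 0.
  apply/eqP => d0; have := congr1 determinant PQ.
  by rewrite det_mulmx d0 mul0r det1 => /eqP; rewrite eq_sym oner_eq0.
by apply: (mulIf dP); rewrite -det_mulmx MP det_mulmx mulrC.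
Qed.

Section frame_endo.
Import passmx.
Variables (R : realType) (k n : nat) (X : 'M[R]_(k, n)).
Hypothesis XX : X *m X^T = 1%:M.
Local Notation H := (rowspan X).

(** The matrix of phi in the coordinates y |-> y *m X of the row space of X. *)
Definition endo_mx (phi : 'End(subvs_of H)) : 'M[R]_k :=
  lin1_mx (mulmxr X^T \o vsval \o phi \o @vsproj _ _ H \o mulmxr X).

Lemma endo_mxE (phi : 'End(subvs_of H)) (v : subvs_of H) :
  vsval (phi v) = vsval v *m X^T *m endo_mx phi *m X.
Proof.
rewrite mul_rV_lin1 /= rowspanP// ?subvsP// rowspanP ?subvsP//.
by rewrite vsvalK.
Qed.

Lemma endo_mx_val (phi : 'End(subvs_of H)) (y : 'rV[R]_k) :
  vsval (phi (vsproj H (y *m X))) = y *m endo_mx phi *m X.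
Proof.
rewrite endo_mxE vsprojK ?mem_rowspan//.
by rewrite -(mulmxA y X) XX mulmx1.
Qed.

Lemma endo_mx_orth (phi : 'End(subvs_of H)) :
  in_O phi <-> endo_mx phi *m (endo_mx phi)^T = 1%:M.
Proof.
split=> [h|h u v].
  apply/matrixP => i j.
  have := h (vsproj H (delta_mx 0 i *m X)) (vsproj H (delta_mx 0 j *m X)).
  rewrite !endo_mx_val !vsprojK ?mem_rowspan// !(dotv_isom _ _ XX).
  rewrite -!rowE; set E := endo_mx phi => h'.
  transitivity (dotv (row i E) (row j E)); last first.
    rewrite h' /dotv (bigD1 i)//= !mxE !eqxx /= mulr1n mul1r eq_sym big1 ?addr0//.
    by move=> l li; rewrite !mxE eqxx (negbTE li) mulr0n mul0r.
  by rewrite !mxE; apply: eq_bigr => l _; rewrite !mxE.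
rewrite !endo_mxE (dotv_isom _ _ XX) (dotv_isom _ _ h) -dotv_mulr.
by rewrite rowspanP// subvsP.
Qed.

(** The matrix of phi in the basis [vbasis] of the row space is conjugate to
    [endo_mx phi], by the change between these coordinates and those of X. *)
Lemma endo_mx_SO (phi : 'End(subvs_of H)) :
  in_SO phi <-> endo_mx phi *m (endo_mx phi)^T = 1%:M /\ \det (endo_mx phi) = 1.
Proof.
pose e := vbasis {:subvs_of H}.
have eb : basis_of {:subvs_of H} e by exact: vbasisP.
suff d : \det (passmx.mxof e e phi) = \det (endo_mx phi).
  by rewrite /in_SO -/e /= d -endo_mx_orth.
pose P := lin1_mx (mulmxr X^T \o @vsval _ _ H \o passmx.vecof e).
pose Q := lin1_mx (passmx.rVof e \o @vsproj _ _ H \o mulmxr X).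
apply: (@det_intertwine _ _ _ _ _ P Q).
- apply/row_matrixP => i; rewrite /P /Q !rowE mulmx1 mulmxA !mul_rV_lin1 /=.
  by rewrite rowspanP ?subvsP// vsvalK passmx.vecofK.
- apply/row_matrixP => i; rewrite /P /Q !rowE mulmx1 mulmxA !mul_rV_lin1 /=.
  rewrite passmx.rVofK// vsprojK ?mem_rowspan//.
  by rewrite -mulmxA XX mulmx1.
- apply/row_matrixP => i; rewrite /P /passmx.mxof /endo_mx !rowE !mulmxA.
  rewrite !mul_rV_lin1 /=.
  rewrite rowspanP ?subvsP// vsvalK.
  by rewrite passmx.rVofK.
Qed.

Definition mx_endo (A : 'M[R]_k) : 'End(subvs_of H) :=
  linfun (@vsproj _ _ H \o mulmxr X \o mulmxr A \o mulmxr X^T \o vsval).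

Lemma mx_endoK (A : 'M[R]_k) : endo_mx (mx_endo A) = A.
Proof.
apply/row_matrixP => i; rewrite !rowE mul_rV_lin1 /= lfunE /=.
rewrite !vsprojK ?mem_rowspan//.
by rewrite -!mulmxA XX mulmx1 (mulmxA X) XX mul1mx.
Qed.

Lemma mx_endo_id (A : 'M[R]_k) : mx_endo A = \1%VF -> A = 1%:M.
Proof.
move=> h; rewrite -[A]mx_endoK h; apply/row_matrixP => i.
rewrite !rowE mul_rV_lin1 /= id_lfunE vsprojK ?mem_rowspan// mulmx1.
by rewrite -mulmxA XX mulmx1.
Qed.
End frame_endo.

(** * Congruences and symmetries of projections *)

Lemma oproj_rowspan (R : realType) k n (X : 'M[R]_(k, n)) (K : set 'rV[R]_n) v :
  X *m X^T = 1%:M ->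
  oproj K (rowspan X) v <-> exists2 z, K z & v = z *m X^T *m X.
Proof.
move=> XX; split=> [[vH [z Kz zv]]|[z Kz ->]]; last first.
  split; first exact: mem_rowspan.
  exists z => // w /(rowspanP XX) <-.
  by rewrite dotv_mulr mulmxBl -(mulmxA _ X) XX mulmx1 subrr dotv0l.
exists z => //; rewrite -[LHS](rowspanP XX vH); congr (_ *m _).
apply/eqP; rewrite eq_sym -subr_eq0 -mulmxBl -dotv_eq0 -dotv_mulr.
by rewrite zv// mem_rowspan.
Qed.

(** The support function of the projection on H is the restriction to H of that
    of K, and an isometry A carries supporting hyperplanes to supporting
    hyperplanes. *)
Lemma congruent_support (R : realType) k n (X : 'M[R]_(k, n)) (K L : set 'rV[R]_n) :
  X *m X^T = 1%:M -> convex_compact K -> convex_compact L ->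
  directly_congruent (rowspan X) (oproj K (rowspan X)) (oproj L (rowspan X)) ->
  exists (A : 'M[R]_k) (a : 'rV[R]_n), [/\ A *m A^T = 1%:M, \det A = 1 &
    forall x, support_fun K (x *m X) =
      support_fun L (x *m A *m X) + dotv (x *m A *m X) a].
Proof.
move=> XX cK cL [phi [a [phiSO aH e]]].
have [AA dA] := (endo_mx_SO XX phi).1 phiSO; set A := endo_mx phi in AA dA.
exists A, a; split=> // x.
have dotE z l : z *m X^T *m A *m X = l *m X^T *m X + a ->
    dotv (x *m X) z = dotv (x *m A *m X) l + dotv (x *m A *m X) a.
  move=> zl; rewrite dotv_mull -(dotv_isom _ _ AA) -(dotv_isom _ _ XX) zl dotvDr.
  by rewrite !dotv_mulr trmxK -(mulmxA _ X) XX mulmx1.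
have KL z : K z -> exists2 l, L l & z *m X^T *m A *m X = l *m X^T *m X + a.
  move=> Kz; have : subspace_image phi (oproj K (rowspan X)) (z *m X^T *m A *m X).
    exists (vsproj (rowspan X) (z *m X^T *m X)); last exact: endo_mx_val.
    rewrite /= vsprojK ?mem_rowspan//; apply/(oproj_rowspan _ _ XX); by exists z.
  by rewrite e => -[_ /(oproj_rowspan _ _ XX)[l Ll ->] <-]; exists l.
have LK l : L l -> exists2 z, K z & z *m X^T *m A *m X = l *m X^T *m X + a.
  move=> Ll; have : translate (oproj L (rowspan X)) a (l *m X^T *m X + a).
    by exists (l *m X^T *m X) => //; apply/(oproj_rowspan _ _ XX); exists l.
  rewrite -e => -[u /= /(oproj_rowspan _ _ XX)[z Kz uz] <-]; exists z => //.
  by rewrite (endo_mxE XX) uz -(mulmxA _ X) XX mulmx1.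
apply/eqP; rewrite eq_le; apply/andP; split.
  apply: support_le => // z /KL[l Ll] /dotE ->; rewrite lerD2r.
  exact: support_ge.
rewrite -lerBrDr; apply: support_le => // l /LK[z Kz] /dotE h.
by rewrite lerBrDr -h support_ge.
Qed.

(** [support_separation] in the coordinates of the row space of X. *)
Lemma projection_separation (R : realType) k n (X : 'M[R]_(k, n)) (K : set 'rV[R]_n)
    (c : 'rV[R]_k) : convex_compact K ->
  (forall v, dotv v c <= support_fun K (v *m X)) -> exists2 z, K z & c = z *m X^T.
Proof.
move=> cK h; have [ck [z0 Kz0] cvK] := cK.
pose C := [set z *m X^T | z in K].
have cC : convex_compact C.
  split.
  - apply: continuous_compact ck; apply: continuous_subspaceT => z.
    apply: (@cvg_mulmx R _ (nbhs z) _ _ _ id (fun=> X^T) z _ (nbhs_filter z)).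
      exact: cvg_id.
    exact: cvg_cst.
  - by exists (z0 *m X^T), z0.
  - move=> _ _ t [x Kx <-] [y Ky <-] t01.
    exists (t *: x + (1 - t) *: y); first exact: cvK.
    by rewrite mulmxDl -!scalemxAl.
have [z Kz <-] : C c; last by exists z.
apply: support_separation => // v; apply: le_trans (h v) _.
apply: support_le => // z Kz; rewrite dotv_mull; apply: support_ge => //.
by exists z.
Qed.

(** By separation the identity between support functions says that the
    transpose of A maps the projection to a translate of itself. *)
Lemma no_O_symmetry_support (R : realType) k n (X : 'M[R]_(k, n)) (K : set 'rV[R]_n)
    (A : 'M[R]_k) (b : 'rV[R]_k) : X *m X^T = 1%:M -> convex_compact K ->
  ~ has_O_symmetry (rowspan X) (oproj K (rowspan X)) -> A *m A^T = 1%:M ->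
  (forall x, support_fun K (x *m X) = support_fun K (x *m A *m X) + dotv x b) ->
  A = 1%:M.
Proof.
move=> XX cK nsym AA h; apply: contrapT => nA; apply: nsym.
have AA' : A^T *m A = 1%:M by exact: mulmx1C.
exists (mx_endo X A^T), (- b *m X); split.
- by apply/(endo_mx_orth XX); rewrite mx_endoK// trmxK.
- move=> /(mx_endo_id XX) AT; apply: nA.
  by rewrite -[A]trmxK AT trmx1.
- exact: mem_rowspan.
apply/seteqP; split=> [_ [u /= /(oproj_rowspan _ _ XX)[z Kz uz] <-]|].
  have [|z' Kz' e] := @projection_separation _ _ _ X K (z *m X^T *m A^T + b) cK.
    move=> v; rewrite dotvDr h lerD2r dotv_mulr trmxK dotv_mulr trmxK.
    exact: support_ge.
  exists (z' *m X^T *m X); first by apply/(oproj_rowspan _ _ XX); exists z'.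
  rewrite (endo_mxE XX) uz mx_endoK// -(mulmxA _ X) XX mulmx1 -e.
  by rewrite mulNmx mulmxDl addrK.
move=> _ [_ /(oproj_rowspan _ _ XX)[z' Kz' ->] <-].
have [|z Kz e] := @projection_separation _ _ _ X K ((z' *m X^T - b) *m A) cK.
  move=> v; rewrite dotv_mulr dotvBr -[v in support_fun _ (v *m _)]mulmx1 -AA'.
  rewrite mulmxA lerBlDr -h dotv_mulr trmxK.
  exact: support_ge.
exists (vsproj (rowspan X) (z *m X^T *m X)).
  by rewrite /= vsprojK ?mem_rowspan//; apply/(oproj_rowspan _ _ XX); exists z.
rewrite (endo_mx_val XX) mx_endoK// -e -(mulmxA _ A) AA mulmx1 mulmxDl.
by [].
Qed.

(** * Width and diameters *)

Lemma enorm_sqr (R : realType) n (v : 'rV[R]_n) : enorm v ^+ 2 = dotv v v.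
Proof. by rewrite sqr_sqrtr// dotv_ge0. Qed.

Lemma enorm_ge0 (R : realType) n (v : 'rV[R]_n) : 0 <= enorm v.
Proof. exact: sqrtr_ge0. Qed.

Lemma usphereP (R : realType) n (v : 'rV[R]_n) : usphere v <-> dotv v v = 1.
Proof.
rewrite /usphere/= -enorm_sqr; split=> [->|/eqP]; first by rewrite expr1n.
rewrite sqrf_eq1 => /orP[/eqP//|/eqP h]; have := enorm_ge0 v; rewrite h; lra.
Qed.

Lemma enorm_eq0 (R : realType) n (v : 'rV[R]_n) : (enorm v == 0) = (v == 0).
Proof. by rewrite -sqrf_eq0 enorm_sqr dotv_eq0. Qed.

Lemma usphere_normalize (R : realType) n (v : 'rV[R]_n) : v != 0 ->
  dotv ((enorm v)^-1 *: v) ((enorm v)^-1 *: v) = 1.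
Proof.
move=> v0; rewrite dotvZl dotvZr -enorm_sqr expr2 mulKf ?mulVf// enorm_eq0//.
Qed.

Lemma widthN (R : realType) n (K : set 'rV[R]_n) v : width K (- v) = width K v.
Proof. by rewrite /width opprK addrC. Qed.

Lemma width_le (R : realType) n (K : set 'rV[R]_n) (d : R) : convex_compact K ->
  (forall v, usphere v -> width K v <= d) -> forall v, width K v <= d * enorm v.
Proof.
move=> cK h v; have [->|v0] := eqVneq v 0.
  have -> : enorm (0 : 'rV[R]_n) = 0 by apply/eqP; rewrite enorm_eq0.
  by rewrite /width oppr0 -(scale0r 0) supportZ// !mul0r addr0 mulr0.
have n0 : 0 < enorm v by rewrite lt_neqAle enorm_ge0 eq_sym enorm_eq0 v0.
have := h ((enorm v)^-1 *: v) ((usphereP _).2 (usphere_normalize v0)).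
have i0 : 0 <= (enorm v)^-1 by rewrite invr_ge0 ltW.
by rewrite /width -scalerN !supportZ// -mulrDr ler_pdivrMl// mulrC.
Qed.

(** Points z and y of K with extreme values along zeta are at distance d, the
    maximal width, so z - y = d zeta; p is the midpoint of this diameter.  The
    lower bound says that z and y belong to K.  As h(v) + h(-v) <= d |v|, lower
    bounds for h(-v) turn into the upper bound. *)
Lemma midpoint_bounds (R : realType) n (K : set 'rV[R]_n) (zeta : 'rV[R]_n) :
  convex_compact K -> usphere zeta ->
  (forall v, usphere v -> width K v <= width K zeta) ->
  exists p, forall v, width K zeta / 2 * `|dotv zeta v| <= support_fun K v - dotv p v
    <= width K zeta * enorm v - width K zeta / 2 * `|dotv zeta v|.
Proof.
move=> cK /usphereP zz mx; set d := width K zeta in mx *.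
have wle := width_le cK mx.
have [[z Kz hz] _] := support_funP zeta cK.
have [[y Ky hy] _] := support_funP (- zeta) cK.
have dE : dotv zeta (z - y) = d by rewrite dotvBr /d /width hz hy dotvNl.
have dn : enorm (z - y) <= d.
  have [->|n0] := eqVneq (z - y) 0.
    have -> : enorm (0 : 'rV[R]_n) = 0 by apply/eqP; rewrite enorm_eq0.
    have := support_ge zeta cK Kz; have := support_ge (- zeta) cK Kz.
    by rewrite dotvNl /d /width; lra.
  have e0 : 0 < enorm (z - y) by rewrite lt_neqAle enorm_ge0 eq_sym enorm_eq0 n0.
  have := wle (z - y); have := support_ge (z - y) cK Kz.
  have := support_ge (- (z - y)) cK Ky; rewrite dotvNl => h1 h2 h3.
  have : dotv (z - y) (z - y) <= d * enorm (z - y).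
    by apply: le_trans h3; rewrite dotvBr /width; lra.
  by rewrite -enorm_sqr expr2 ler_pM2r.
have d0 : 0 <= d by apply: le_trans (enorm_ge0 _) dn.
have zy : z - y = d *: zeta.
  apply/eqP; rewrite -subr_eq0 -dotv_eq0 eq_le dotv_ge0 andbT.
  rewrite dotv_sqrB zz mulr1 (dotvC (z - y)) dE -enorm_sqr.
  have : enorm (z - y) ^+ 2 <= d ^+ 2 by rewrite ler_pXn2r ?nnegrE ?enorm_ge0.
  rewrite !expr2; lra.
exists (y + (d / 2) *: zeta) => v.
have hzv := support_ge v cK Kz; have hyv := support_ge v cK Ky.
have hzNv := support_ge (- v) cK Kz; have hyNv := support_ge (- v) cK Ky.
have wv := wle v; rewrite /width in wv; rewrite !dotvNl in hzNv hyNv.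
have zE : dotv v z = dotv v y + d * dotv zeta v.
  by rewrite -[z](subrK y) zy dotvDr dotvZr addrC (dotvC v zeta).
rewrite dotvDl dotvZl (dotvC y v).
by case: (ger0P (dotv zeta v)) => _; apply/andP; split; lra.
Qed.

(** The right-hand side vanishes to second order at e, a linear form only to first
    order unless it is zero. *)
Lemma linear_form_vanish (R : realType) n (d : R) (b e : 'rV[R]_n) : dotv e e = 1 ->
  (forall x, `|dotv b x| <= d * (enorm x - `|dotv e x|)) -> b = 0.
Proof.
move=> ee h; have e1 : enorm e = 1 by apply/usphereP.
have be : dotv b e = 0.
  by apply/eqP; rewrite -normr_le0; have := h e; rewrite ee e1 normr1 subrr mulr0.
apply/eqP; rewrite -dotv_eq0; apply: contraT => B0.
have {B0} B0 : 0 < dotv b b by rewrite lt_neqAle dotv_ge0 eq_sym B0.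
set B := dotv b b in B0.
pose t := (`|d| + 1)^-1; have D0 : 0 < `|d| + 1 by rewrite ltr_wpDl.
have t0 : 0 < t by rewrite invr_gt0.
have dt : `|d| * t < 1 by rewrite ltr_pdivrMr// mul1r ltrDl.
have := h (e + t *: b).
rewrite !dotvDr !dotvZr be ee add0r (dotvC e b) be mulr0 addr0 normr1 -/B.
rewrite ger0_norm; last by rewrite mulr_ge0// ltW.
have enE : dotv (e + t *: b) (e + t *: b) = 1 + t ^+ 2 * B.
  by rewrite dotvDl !dotvDr !dotvZl !dotvZr (dotvC e b) be ee -/B; ring.
have en : enorm (e + t *: b) <= 1 + t ^+ 2 * B / 2.
  have p0 : 0 <= t ^+ 2 * B / 2 by rewrite divr_ge0// mulr_ge0 ?sqr_ge0// ltW.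
  rewrite -(@ler_pXn2r _ 2)// ?nnegrE ?enorm_ge0 ?addr_ge0// enorm_sqr.
  by rewrite enE sqrrD expr1n; have := sqr_ge0 (t ^+ 2 * B / 2); lra.
have en1 : 1 <= enorm (e + t *: b).
  rewrite -(@ler_pXn2r _ 2)// ?nnegrE ?enorm_ge0// enorm_sqr expr1n.
  by rewrite enE; have := mulr_ge0 (sqr_ge0 t) (ltW B0); lra.
move=> h1; have h2 : d * (enorm (e + t *: b) - 1) <= `|d| * (t ^+ 2 * B / 2).
  apply: le_trans (ler_norm _) _; rewrite normrM ler_wpM2l// ger0_norm; lra.
have : t * B * (1 - `|d| * t / 2) <= 0 by rewrite expr2 in h2; lra.
rewrite leNgt mulr_gt0// ?mulr_gt0//; lra.
Qed.

(** * Orthonormal frames and generic vectors *)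

Lemma orth_extend (R : realType) k n (X : 'M[R]_(k, n)) (v : 'rV[R]_n) :
  X *m X^T = 1%:M -> (k < n)%N ->
  exists e : 'rV[R]_n, [/\ dotv e e = 1, e *m X^T = 0 &
    exists c (s : R), v = c *m X + s *: e].
Proof.
move=> XX kn.
have normalize (r : 'rV[R]_n) : r != 0 -> r *m X^T = 0 ->
    exists e : 'rV[R]_n, [/\ dotv e e = 1, e *m X^T = 0 & exists s : R, r = s *: e].
  move=> r0 rX; pose d := Num.sqrt (dotv r r).
  have d2 : d ^+ 2 = dotv r r by rewrite sqr_sqrtr// dotv_ge0.
  have d0 : d != 0 by rewrite -sqrf_eq0 d2 dotv_eq0.
  exists (d^-1 *: r); split.
  - by rewrite dotvZl dotvZr -d2 expr2 mulKf ?mulVf.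
  - by rewrite -scalemxAl rX scaler0.
  - by exists d; rewrite scalerA divff// scale1r.
pose r := v - v *m X^T *m X.
have rX : r *m X^T = 0 by rewrite mulmxBl -(mulmxA _ X) XX mulmx1 subrr.
have [r0|r0] := eqVneq r 0; last first.
  have [e [ee eX [s rs]]] := normalize r r0 rX; exists e; split => //.
  by exists (v *m X^T), s; rewrite -rs addrC subrK.
have kz : kermx X^T != 0.
  rewrite -mxrank_eq0 mxrank_ker subn_eq0 -ltnNge.
  by apply: leq_ltn_trans (rank_leq_col _) kn.
have [||e [ee eX _]] := normalize (nz_row (kermx X^T)).
- by rewrite nz_row_eq0.
- by apply/eqP; rewrite -sub_kermx nz_row_sub.
exists e; split => //; exists (v *m X^T), 0.
by rewrite scale0r addr0; apply/eqP; rewrite -subr_eq0 -/r r0.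
Qed.

(** Gram-Schmidt, completed by arbitrary vectors when those of V are dependent. *)
Lemma orth_complete (R : realType) m k n (X : 'M[R]_(k, n)) (V : 'M[R]_(m, n)) :
  X *m X^T = 1%:M -> (k + m <= n)%N ->
  exists J : 'M[R]_(m, n), [/\ J *m J^T = 1%:M, J *m X^T = 0 &
    exists C S, V = C *m X + S *m J].
Proof.
elim: m k X V => [|m IH] k X V XX kmn.
  exists 0; split; rewrite ?mul0mx //; first by apply/matrixP => -[].
  by exists 0, 0; apply/matrixP => -[].
have kn : (k < n)%N by apply: leq_trans kmn; rewrite addnS ltnS leq_addr.
have [e [ee eX [c [s v1]]]] := orth_extend (usubmx (V : 'M[R]_(1 + m, n))) XX kn.
have Xe : X *m e^T = 0 by rewrite -[LHS]trmxK trmx_mul trmxK eX trmx0.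
have e1 : e *m e^T = 1%:M.
  by rewrite [LHS]mx11_scalar -dotvE ee.
have XX' : col_mx X e *m (col_mx X e)^T = 1%:M.
  by rewrite tr_col_mx mul_col_row XX eX Xe e1 -scalar_mx_block.
have [|J [JJ JX [C [S VE]]]] := IH _ (col_mx X e) (dsubmx (V : 'M[R]_(1 + m, n))) XX'.
  by rewrite addn1 addSn -addnS.
have [JX1 Je] : J *m X^T = 0 /\ J *m e^T = 0.
  move: JX; rewrite tr_col_mx mul_mx_row -[0]hsubmxK => /eq_row_mx[-> ->].
  by rewrite !linear0.
have eJ : e *m J^T = 0 by rewrite -[LHS]trmxK trmx_mul trmxK Je trmx0.
suff : exists J : 'M[R]_(1 + m, n), [/\ J *m J^T = 1%:M, J *m X^T = 0 &
    exists C S, (V : 'M[R]_(1 + m, n)) = C *m X + S *m J] by [].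
exists (col_mx e J); split.
- by rewrite tr_col_mx mul_col_row e1 JJ Je eJ -scalar_mx_block.
- by rewrite mul_col_mx eX JX1 col_mx0.
exists (col_mx c (lsubmx C)), (block_mx s%:M 0 (rsubmx C) S).
rewrite mul_col_mx mul_block_col add_col_mx mul0mx addr0 mul_scalar_mx -v1.
rewrite addrA -mul_row_col hsubmxK -VE.
by rewrite vsubmxK.
Qed.

Lemma roots_finite (R : realType) (p : {poly R}) : p != 0 ->
  finite_set [set x | root p x].
Proof.
have [m] := ubnP (size p); elim: m p => // m IH p; rewrite ltnS => sp p0.
have [[x rx]|nr] := pselect (exists x, root p x); last first.
  rewrite (_ : [set x | _] = set0)//; apply/seteqP; split=> // x rx.
  by apply: nr; exists x.
have /factor_theorem[q pq] := rx.
have q0 : q != 0 by apply: contraNneq p0 => q0; rewrite pq q0 mul0r.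
have fq : finite_set [set y | root q y].
  apply: IH => //; apply: leq_trans sp.
  by rewrite pq size_Mmonic ?monicXsubC// size_XsubC addn2.
apply: (@sub_finite_set _ _ ([set y | root q y] `|` [set x])).
  by move=> y /=; rewrite pq rootM root_XsubC => /orP[|/eqP]; [left|right].
by rewrite finite_setU; split => //; exact: finite_set1.
Qed.

Lemma countable_notin (R : realType) (A : set R) (d : R) : countable A -> 0 < d ->
  exists2 t, 0 < t < d & ~ A t.
Proof.
move=> cA d0; apply: contrapT => h.
have sA : `]0, d[%classic `<=` A.
  move=> t /=; rewrite in_itv /= => td; apply: contrapT => nA; apply: h.
  by exists t.
have := countable_lebesgue_measure0 (sub_countable (subset_card_le sA) cA).
by rewrite lebesgue_measure_itv /= lte_fin d0 sube0 => -[] d00; rewrite d00 ltxx in d0.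
Qed.

(** Along the curve w0 + (t, t^2, ...) the condition dotv y w = 0 becomes a
    nonzero polynomial equation in t.  Countably many such equations leave out
    arbitrarily small values of t. *)
Lemma closure_generic (R : realType) k (N : set 'rV[R]_k) (w0 : 'rV[R]_k) :
  countable N -> (forall y, N y -> y != 0) ->
  closure [set w | forall y, N y -> dotv y w != 0] w0.
Proof.
move=> cN N0 U Uw.
pose f (t : R) := w0 + \row_i t ^+ i.+1.
pose p (y : 'rV[R]_k) : {poly R} := (dotv y w0)%:P + \sum_(i < k) y 0 i *: 'X^(i.+1).
have pE y t : (p y).[t] = dotv y (f t).
  rewrite /p hornerD hornerC horner_sum dotvDr; congr (_ + _).
  by apply: eq_bigr => i _; rewrite hornerZ hornerXn mxE.
have p0 y : N y -> p y != 0.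
  move=> /N0 y0; apply: contraNneq y0 => py; apply/eqP/rowP => i; rewrite mxE.
  have := congr1 (fun q : {poly R} => q`_i.+1) py.
  rewrite coef0 coefD coefC /= add0r coef_sum (bigD1 i)//= coefZ coefXn eqxx mulr1.
  rewrite big1 ?addr0// => j ji; rewrite coefZ coefXn eqSS.
  by rewrite (_ : (i == j :> nat) = false) ?mulr0//; apply/negbTE; rewrite eq_sym.
have cB : countable (\bigcup_(y in N) [set t | root (p y) t]).
  apply: bigcup_countable => // y Ny; apply: finite_set_countable.
  by apply: roots_finite; exact: p0.
have f0 : f t @[t --> 0] --> w0.
  apply: cvg_mx => i j; rewrite ord1.
  have -> : (fun t => f t 0 j) = (fun t : R => w0 0 j + t ^+ j.+1).
    by apply/funext => t; rewrite !mxE.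
  rewrite -[X in _ --> X]addr0; apply: cvgD; first exact: cvg_cst.
  rewrite -[X in _ --> X](expr0n R j.+1) /=; apply: exprn_continuous.
have /nbhs_ballP[d /= d0 dU] : nbhs (0 : R) (f @^-1` U) by exact: f0.
have [t /andP[t0 td] nt] := countable_notin cB d0.
exists (f t); split.
  move=> y Ny; rewrite -pE; apply/negP => /eqP r; apply: nt; exists y => //=.
  by apply/rootP.
by apply: dU; rewrite /ball /= sub0r normrN gtr0_norm.
Qed.

(** * The side spaces *)

(** A basis of the space generated by zeta and by the hyperplane orthogonal to w
    in the row space of J; it is orthonormal when zeta and the rows of J are
    orthonormal and w is a unit vector. *)
Definition hframe (R : realType) n (zeta : 'rV[R]_n) (J : 'M[R]_(4, n))
    (w : 'rV[R]_4) : 'M[R]_(1 + 3, n) := col_mx zeta (qframe w *m J).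

Lemma zeta_gram (R : realType) n (zeta : 'rV[R]_n) :
  dotv zeta zeta = 1 -> zeta *m zeta^T = 1%:M.
Proof. by move=> zz; rewrite [LHS]mx11_scalar -dotvE zz. Qed.

Lemma qframeJ_orth (R : realType) n (J : 'M[R]_(4, n)) (w : 'rV[R]_4) :
  J *m J^T = 1%:M -> dotv w w = 1 ->
  (qframe w *m J) *m (qframe w *m J)^T = 1%:M.
Proof.
move=> JJ ww.
by rewrite trmx_mul mulmxA -(mulmxA _ J) JJ mulmx1 qframe_orth ww.
Qed.

Lemma hframe_orth (R : realType) n (zeta : 'rV[R]_n) (J : 'M[R]_(4, n))
    (w : 'rV[R]_4) : dotv zeta zeta = 1 -> J *m J^T = 1%:M ->
  J *m zeta^T = 0 -> dotv w w = 1 ->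
  hframe zeta J w *m (hframe zeta J w)^T = 1%:M.
Proof.
move=> zz JJ Jz ww; have zJ : zeta *m J^T = 0.
  by rewrite -[LHS]trmxK trmx_mul trmxK Jz trmx0.
rewrite tr_col_mx mul_col_row zeta_gram// qframeJ_orth//.
by rewrite trmx_mul mulmxA zJ mul0mx -mulmxA Jz mulmx0 -scalar_mx_block.
Qed.

Lemma row_hframe (R : realType) n (zeta : 'rV[R]_n) (J : 'M[R]_(4, n))
    (w : 'rV[R]_4) (s : R) (y : 'rV[R]_3) :
  row_mx s%:M y *m hframe zeta J w = s *: zeta + y *m qframe w *m J.
Proof. by rewrite mul_row_col mul_scalar_mx mulmxA. Qed.

Lemma rowspan_hframe_side (R : realType) n (zeta : 'rV[R]_n) (J : 'M[R]_(4, n))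
    (w : 'rV[R]_4) : dotv zeta zeta = 1 -> J *m J^T = 1%:M ->
  J *m zeta^T = 0 -> dotv w w = 1 ->
  (rowspan (hframe zeta J w) :&: orthv zeta)%VS = rowspan (qframe w *m J).
Proof.
move=> zz JJ Jz ww; have XX := hframe_orth zz JJ Jz ww.
have YY := qframeJ_orth JJ ww.
apply/vspaceP => v; rewrite memv_cap mem_orthv; apply/andP/idP => [[vX /eqP vz]|vY].
  rewrite -(rowspanP XX vX) tr_col_mx mul_mx_row mul_row_col.
  have -> : v *m zeta^T = 0 by rewrite [LHS]mx11_scalar -dotvE vz raddf0.
  by rewrite mul0mx add0r mem_rowspan.
rewrite -(rowspanP YY vY); set y := v *m _; split.
  have -> : y *m (qframe w *m J) = row_mx 0%:M y *m hframe zeta J w.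
    by rewrite row_hframe scale0r add0r mulmxA.
  exact: mem_rowspan.
by rewrite dotvE -!mulmxA Jz !mulmx0 mxE.
Qed.

(** An orthogonal matrix that preserves the first axis also preserves its
    orthogonal complement; the sign on the axis is \det rho because the
    determinants multiply to 1. *)
Lemma orth_block (R : realType) k (A : 'M[R]_(1 + k)) :
  A *m A^T = 1%:M -> \det A = 1 -> ursubmx A = 0 ->
  exists rho : 'M[R]_k, [/\ rho *m rho^T = 1%:M,
    A = block_mx (\det rho)%:M 0 0 rho & \det rho ^+ 2 = 1].
Proof.
move=> AA dA ur0; have AA' := mulmx1C AA.
move: AA AA' dA; rewrite -[A]submxK ur0.
set a := ulsubmx A; set b := dlsubmx A; set rho := drsubmx A.
rewrite tr_block_mx !mulmx_block !trmx0 !mul0mx !mulmx0 !addr0 [1%:M]scalar_mx_block.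
move=> /eq_block_mx[aa _ _ _] /eq_block_mx[ab _ _ rr'].
have b0 : b = 0.
  apply/colP => i; rewrite mxE.
  have : b^T *m b = 0.
    apply: (addrI (a^T *m a)); rewrite ab addr0 -aa; congr (_ *m _);
    by apply/matrixP => ? ?; rewrite !ord1 ?mxE.
  move=> /matrixP/(_ 0 0); rewrite !mxE => /eqP.
  rewrite psumr_eq0 => [/allP/(_ i (mem_index_enum _))|j _];
    rewrite !mxE -expr2 ?sqr_ge0//.
  by rewrite sqrf_eq0 => /eqP.
have rr : rho *m rho^T = 1%:M by apply: mulmx1C; move: rr'; rewrite add0r.
rewrite b0 det_ublock [a]mx11_scalar det_scalar1 => ar.
have d2 : \det rho ^+ 2 = 1 by rewrite expr2 -{2}(det_tr rho) -det_mulmx rr det1.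
exists rho; split=> //; congr (block_mx _%:M _ _ _).
by rewrite -[LHS]mulr1 -d2 expr2 mulrA ar mul1r.
Qed.

Lemma support_translate (R : realType) n (K L : set 'rV[R]_n) (b : 'rV[R]_n) :
  convex_compact K -> convex_compact L ->
  (forall v, support_fun K v = support_fun L v + dotv v b) -> K = translate L b.
Proof.
move=> cK cL h; apply/seteqP; split=> [z Kz|_ [z Lz <-]].
  exists (z - b); last exact: subrK.
  apply: support_separation => // v; rewrite dotvBr lerBlDr -h.
  exact: support_ge.
apply: support_separation => // v; rewrite dotvDr h lerD2r.
exact: support_ge.
Qed.

Lemma convex_compact_opp (R : realType) n (L : set 'rV[R]_n) : convex_compact L ->
  convex_compact [set - x | x in L] /\
  forall v, support_fun [set - x | x in L] v = support_fun L (- v).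
Proof.
move=> cL; have [ck [z Lz] cv] := cL.
have cNL : convex_compact [set - x | x in L].
  split.
  - apply: continuous_compact ck; apply: continuous_subspaceT => x.
    apply: (@cvgN _ 'rV[R]_n _ (nbhs x) (nbhs_filter x) id x); exact: cvg_id.
  - by exists (- z), z.
  - move=> _ _ t [x Lx <-] [y Ly <-] t01.
    exists (t *: x + (1 - t) *: y); first exact: cv.
    by rewrite opprD !scalerN.
split=> // v; apply/eqP; rewrite eq_le; apply/andP; split.
  apply: support_le => // _ [x Lx <-]; rewrite dotvNr -dotvNl.
  exact: support_ge.
apply: support_le => // x Lx; rewrite dotvNl -dotvNr; apply: support_ge => //.
by exists x.
Qed.

(** Both sides are within the bounds of [midpoint_bounds], which A respects since
    it preserves norms and the component along zeta up to sign.  They differ by a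
    linear form, so [linear_form_vanish] applies at zeta.  Thus recentring at the
    midpoints of the diameters parallel to zeta absorbs the translation. *)
Lemma centered_congruence (R : realType) n (K L : set 'rV[R]_n) (d : R)
    (zeta pK pL a : 'rV[R]_n) (X : 'M[R]_(1 + 3, n)) (rho : 'M[R]_3) :
  let A := block_mx (\det rho)%:M 0 0 rho in
  X *m X^T = 1%:M -> A *m A^T = 1%:M -> \det rho ^+ 2 = 1 ->
  zeta = row_mx 1%:M 0 *m X ->
  (forall v, d / 2 * `|dotv zeta v| <= support_fun K v - dotv pK v
    <= d * enorm v - d / 2 * `|dotv zeta v|) ->
  (forall v, d / 2 * `|dotv zeta v| <= support_fun L v - dotv pL v
    <= d * enorm v - d / 2 * `|dotv zeta v|) ->
  (forall x, support_fun K (x *m X) =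
    support_fun L (x *m A *m X) + dotv (x *m A *m X) a) ->
  forall x, support_fun K (x *m X) - dotv pK (x *m X) =
    support_fun L (x *m A *m X) - dotv pL (x *m A *m X).
Proof.
move=> A XX AA d2 zX bK bL h.
pose e0 : 'rV[R]_(1 + 3) := row_mx 1%:M 0.
have ee : dotv e0 e0 = 1.
  by rewrite dotvE tr_row_mx mul_row_col trmx0 mul0mx addr0 trmx1 mulmx1 mxE.
pose b := (pL + a) *m X^T *m A^T - pK *m X^T.
have bE x : support_fun K (x *m X) - dotv pK (x *m X) -
    (support_fun L (x *m A *m X) - dotv pL (x *m A *m X)) = dotv b x.
  by rewrite h (dotvC _ a) /b dotvBl !dotv_mull !trmxK dotvDl; ring.
suff b0 : b = 0.
  by move=> x; apply/eqP; rewrite -subr_eq0 bE b0 dotv0l.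
apply: (linear_form_vanish (d := d) ee) => x.
have n1 : enorm (x *m X) = enorm x by rewrite /enorm dotv_isom.
have n2 : enorm (x *m A *m X) = enorm x by rewrite /enorm !dotv_isom.
have z1 : dotv zeta (x *m X) = dotv e0 x by rewrite zX dotv_isom.
have z2 : `|dotv zeta (x *m A *m X)| = `|dotv e0 x|.
  rewrite zX dotv_isom// dotv_mulr tr_block_mx mul_row_block !trmx0 !mul0mx !addr0.
  rewrite mulmx0 tr_scalar_mx mul1mx -[0](scaler0 _ (\det rho)).
  rewrite -[X in row_mx X]mulmx1 mul_scalar_mx.
  rewrite -scale_row_mx dotvZl normrM.
  have -> : `|\det rho| = 1.
    by apply/eqP; rewrite -(@eqrXn2 _ 2)// real_normK ?num_real// d2 expr1n.
  by rewrite mul1r.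
have /andP[k1 k2] := bK (x *m X); have /andP[l1 l2] := bL (x *m A *m X).
rewrite n1 z1 in k1 k2; rewrite n2 z2 in l1 l2.
rewrite -bE ler_norml; apply/andP; split; lra.
Qed.

Lemma cvg_affine (R : realType) n (zeta : 'rV[R]_n) (J : 'M[R]_(4, n))
    (z : R * 'rV[R]_4) : y.1 *: zeta + y.2 *m J @[y --> z] --> z.1 *: zeta + z.2 *m J.
Proof.
apply: cvg_mx => i j; rewrite !mxE; under eq_fun do rewrite !mxE.
apply: cvgD; first by apply: cvgM; [exact: cvg_fst|exact: cvg_cst].
apply: cvg_big => [|k _]; first exact: add_continuous.
apply: cvgM; last exact: cvg_cst.
by apply: (cvg_coord (f := fun y : R * 'rV[R]_4 => y.2)); exact: cvg_snd.
Qed.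

Lemma continuous_support_affine (R : realType) n (K : set 'rV[R]_n)
    (zeta p : 'rV[R]_n) (J : 'M[R]_(4, n)) : convex_compact K ->
  continuous (fun z : R * 'rV[R]_4 => support_fun K (z.1 *: zeta + z.2 *m J)
    - dotv p (z.1 *: zeta + z.2 *m J)).
Proof.
move=> cK z; apply: cvgB; last by apply: cvg_dotv; [exact: cvg_cst|exact: cvg_affine].
apply: (@continuous_cvg _ _ _ _ _
  (fun z : R * 'rV[R]_4 => z.1 *: zeta + z.2 *m J) (support_fun K)).
  exact: support_continuous.
exact: cvg_affine.
Qed.

(** * Projections of the two bodies *)

Section projections.
Variables (R : realType) (n : nat) (K L : set 'rV[R]_n) (zeta : 'rV[R]_n).
Hypotheses (cK : convex_compact K) (cL : convex_compact L) (uz : usphere zeta).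
Hypothesis cong : forall H : {vspace 'rV[R]_n}, \dim H = 4%N -> zeta \in H ->
  directly_congruent H (oproj K H) (oproj L H).
Hypothesis asym : forall H : {vspace 'rV[R]_n}, \dim H = 4%N -> zeta \in H ->
  ~ has_O_symmetry (H :&: orthv zeta)%VS (oproj K (H :&: orthv zeta)%VS).
Hypothesis maxK : forall v, usphere v -> width K v <= width K zeta.
Hypothesis cntL : countable (max_width_dirs L).

Let zz : dotv zeta zeta = 1. Proof. exact/usphereP. Qed.
Let frame (J : 'M[R]_(4, n)) := J *m J^T = 1%:M /\ J *m zeta^T = 0.

Lemma zeta_hframe (J : 'M[R]_(4, n)) w :
  zeta = row_mx 1%:M 0 *m hframe zeta J w.
Proof. by rewrite row_hframe scale1r mul0mx mul0mx addr0. Qed.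

Lemma hframe_dim (J : 'M[R]_(4, n)) w : frame J -> dotv w w = 1 ->
  \dim (rowspan (hframe zeta J w)) = 4%N /\ zeta \in rowspan (hframe zeta J w).
Proof.
move=> [JJ Jz] ww; split; first exact: (dim_rowspan (hframe_orth zz JJ Jz ww)).
by rewrite [X in X \in _](zeta_hframe J w) mem_rowspan.
Qed.

Lemma side_congruence (J : 'M[R]_(4, n)) w : frame J -> dotv w w = 1 ->
  exists (A : 'M[R]_(1 + 3)) (a : 'rV[R]_n), [/\ A *m A^T = 1%:M, \det A = 1 &
    forall x, support_fun K (x *m hframe zeta J w) =
      support_fun L (x *m A *m hframe zeta J w) + dotv (x *m A *m hframe zeta J w) a].
Proof.
move=> fJ ww; have [dH zH] := hframe_dim fJ ww; case: fJ => JJ Jz.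
exact: (congruent_support (hframe_orth zz JJ Jz ww) cK cL (cong dH zH)).
Qed.

Lemma side_width (A : 'M[R]_(1 + 3)) (X : 'M[R]_(1 + 3, n)) a :
  (forall x, support_fun K (x *m X) =
    support_fun L (x *m A *m X) + dotv (x *m A *m X) a) ->
  forall x, width K (x *m X) = width L (x *m A *m X).
Proof.
move=> h x; rewrite /width -mulNmx !h !mulNmx dotvNl; ring.
Qed.

Hypothesis frames : forall x y, exists2 J : 'M[R]_(4, n), frame J &
  exists s c t e, x = s *: zeta + c *m J /\ y = t *: zeta + e *m J.

(** Every direction lies in a side space H, where the widths of K and L
    correspond under an isometry. *)
Lemma maxL v : usphere v -> width L v <= width K zeta.
Proof.
move=> uv; have [J fJ [s [c [_ [_ [vE _]]]]]] := frames v 0.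
have [w w0 [x cE]] := qframe_span c.
have ww := usphere_normalize w0; set w' := _ *: w in ww.
have [A [a [AA dA h]]] := side_congruence fJ ww.
have XX := hframe_orth zz fJ.1 fJ.2 ww.
pose y : 'rV[R]_(1 + 3) := row_mx s%:M (enorm w *: x).
have vX : v = y *m hframe zeta J w'.
  rewrite row_hframe vE cE -scalemxAl qframeZ -scalemxAr scalerA.
  by rewrite divff ?scale1r// enorm_eq0.
have AA' := mulmx1C AA.
have e : v = y *m A^T *m A *m hframe zeta J w' by rewrite -(mulmxA y) AA' mulmx1.
rewrite e -(side_width h); apply: maxK; apply/usphereP.
rewrite dotv_isom// dotv_isom ?trmxK// -(dotv_isom _ _ XX) -vX.
exact/usphereP.
Qed.

Lemma width_maxL (v : 'rV[R]_n) : usphere v -> width L v = width K zeta ->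
  max_width_dirs L v.
Proof. by move=> uv e; split=> // u /maxL; rewrite e. Qed.

(* The vector [const_mx 1] excludes w = 0. *)
Let generic (J : 'M[R]_(4, n)) : set 'rV[R]_4 :=
  [set y | y = const_mx 1 \/ y != 0 /\ exists2 v, max_width_dirs L v & y = v *m J^T].
Let good (J : 'M[R]_(4, n)) := [set w | forall y, generic J y -> dotv y w != 0].

Lemma closure_good J w : closure (good J) w.
Proof.
apply: closure_generic => [|y [->|[]//]].
  apply: (@sub_countable _ _ _ (\bigcup_(b in [set: bool])
      if b then [set const_mx 1] else (fun v => v *m J^T) @` max_width_dirs L)).
    apply: subset_card_le => y [->|[_ [v Mv ->]]]; first by exists true.
    by exists false => //; exists v.
  apply: bigcup_countable => [|[] _]; [exact: countableP|exact: countable1|].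
  exact: sub_countable (card_image_le _ _) cntL.
by apply/eqP => /rowP/(_ 0); rewrite !mxE => /eqP; rewrite oner_eq0.
Qed.

Lemma good_neq0 J w : good J w -> w != 0.
Proof.
move=> gw; have := gw (const_mx 1) (or_introl erefl).
by apply: contraNneq => ->; rewrite dotv0r.
Qed.

(** The congruence A carries zeta to a direction of maximal width of L.  For
    generic w the only such directions in H are zeta and - zeta, because the
    countably many others project on the row space of J to nonzero vectors that
    are not orthogonal to w. *)
Lemma good_block (J : 'M[R]_(4, n)) w : frame J -> good J w -> dotv w w = 1 ->
  exists (rho : 'M[R]_3) (a : 'rV[R]_n),
  let A := block_mx (\det rho)%:M 0 0 rho in
  [/\ rho *m rho^T = 1%:M, A *m A^T = 1%:M, \det rho ^+ 2 = 1 &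
    forall x, support_fun K (x *m hframe zeta J w) =
      support_fun L (x *m A *m hframe zeta J w) + dotv (x *m A *m hframe zeta J w) a].
Proof.
move=> fJ gw ww; have [A [a [AA dA h]]] := side_congruence fJ ww.
have XX := hframe_orth zz fJ.1 fJ.2 ww.
pose e0 : 'rV[R]_(1 + 3) := row_mx 1%:M 0.
have zX := zeta_hframe J w.
have Mv : max_width_dirs L (e0 *m A *m hframe zeta J w).
  apply: width_maxL; last by rewrite -(side_width h) -zX.
  by apply/usphereP; rewrite dotv_isom// dotv_isom// -(dotv_isom _ _ XX) -zX.
have ur0 : ursubmx A = 0.
  have vJ : e0 *m A *m hframe zeta J w *m J^T = ursubmx A *m qframe w.
    rewrite -[A in LHS]submxK mul_row_block !mul0mx !addr0 !mul1mx mul_row_col.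
    rewrite mulmxDl -!mulmxA fJ.1 mulmx1.
    have -> : zeta *m J^T = 0 by rewrite -[LHS]trmxK trmx_mul trmxK fJ.2 trmx0.
    by rewrite mulmx0 add0r.
  have q0 : ursubmx A *m qframe w = 0.
    apply: contrapT => /eqP ne.
    have := gw (ursubmx A *m qframe w) (or_intror (conj ne _)).
    rewrite dotvE -mulmxA qframe_perp mulmx0 mxE eqxx => H; apply: notF; apply: H.
    by exists (e0 *m A *m hframe zeta J w).
  have := congr1 (fun B => B *m (qframe w)^T) q0.
  by rewrite -mulmxA qframe_orth ww mulmx1 mul0mx.
have [rho [rr AE d2]] := orth_block AA dA ur0.
by exists rho, a; rewrite -AE.
Qed.

Lemma width_zeta : width L zeta = width K zeta.
Proof.
have [J fJ _] := frames 0 0.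
have [w [gw _]] := @closure_good J 0 setT filterT.
have w0 := good_neq0 gw; have ww := usphere_normalize w0; set w' := _ *: w in ww.
have gw' : good J w'.
  move=> y /gw y0; rewrite dotvZr mulf_neq0// invr_eq0 enorm_eq0//.
have [rho [a [rr AA d2 h]]] := good_block fJ gw' ww.
have zX := zeta_hframe J w'.
rewrite [in RHS]zX (side_width h) mul_row_block.
rewrite !mulmx0 !mul0mx !addr0 mul1mx row_hframe !mul0mx addr0.
move/eqP: d2; rewrite sqrf_eq1 => /orP[] /eqP ->; first by rewrite scale1r.
by rewrite scaleN1r widthN.
Qed.

(** [signed_congruence] for the recentred support functions of K and L on the
    5-dimensional space generated by zeta and the rows of J. *)
Lemma signed_eq_on_frame (pK pL : 'rV[R]_n) (J : 'M[R]_(4, n)) : frame J ->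
  (forall v, width K zeta / 2 * `|dotv zeta v| <= support_fun K v - dotv pK v
    <= width K zeta * enorm v - width K zeta / 2 * `|dotv zeta v|) ->
  (forall v, width K zeta / 2 * `|dotv zeta v| <= support_fun L v - dotv pL v
    <= width K zeta * enorm v - width K zeta / 2 * `|dotv zeta v|) ->
  exists2 e : R, e = 1 \/ e = -1 & forall s y,
    support_fun K (s *: zeta + y *m J) - dotv pK (s *: zeta + y *m J) =
    support_fun L (e *: (s *: zeta + y *m J)) - dotv pL (e *: (s *: zeta + y *m J)).
Proof.
move=> fJ bK bL.
pose F s (y : 'rV[R]_4) :=
  support_fun K (s *: zeta + y *m J) - dotv pK (s *: zeta + y *m J).
pose G s (y : 'rV[R]_4) :=
  support_fun L (s *: zeta + y *m J) - dotv pL (s *: zeta + y *m J).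
have [|||||e epm FG] := @signed_congruence R F G (good J).
- exact: continuous_support_affine.
- exact: continuous_support_affine.
- by move=> w _; exact: closure_good.
- move=> w gw; have w0 := good_neq0 gw; have ww := usphere_normalize w0.
  have n0 : enorm w != 0 by rewrite enorm_eq0.
  set w' := _ *: w in ww.
  have gw' : good J w'.
    by move=> y /gw y0; rewrite dotvZr mulf_neq0// invr_eq0.
  have [rho [a [rr AA d2 h]]] := good_block fJ gw' ww.
  exists rho => // s x.
  have xw (u : 'rV[R]_3) : u *m qframe w = (enorm w *: u) *m qframe w'.
    by rewrite qframeZ -scalemxAr -scalemxAl scalerA mulVf// scale1r.
  have := centered_congruence (hframe_orth zz fJ.1 fJ.2 ww) AA d2
    (zeta_hframe J w') bK bL h.
  move=> /(_ (row_mx s%:M (enorm w *: x))).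
  rewrite mul_row_block !mulmx0 addr0 add0r !row_hframe -scalar_mxM row_hframe.
  by rewrite /F /G !xw -!scalemxAl (mulrC s).
- move=> w w0 rho rr h; have ww := usphere_normalize w0.
  set w' := _ *: w in ww.
  have YY := qframeJ_orth fJ.1 ww.
  have [dH zH] := hframe_dim fJ ww; have := asym dH zH.
  rewrite (rowspan_hframe_side zz fJ.1 fJ.2 ww) => ns.
  pose q := pK *m (qframe w' *m J)^T.
  apply: (no_O_symmetry_support (b := q - q *m rho^T) YY cK ns rr) => x.
  have := h ((enorm w)^-1 *: x); rewrite /F !scale0r !add0r.
  have xw (u : 'rV[R]_3) : ((enorm w)^-1 *: u) *m qframe w = u *m qframe w'.
    by rewrite qframeZ -scalemxAr -scalemxAl.
  rewrite -(scalemxAl _ x rho) !xw => e.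
  rewrite /q dotvBr !dotv_mulr !trmxK.
  rewrite -!mulmxA in e *; rewrite !(dotvC _ pK); lra.
exists e => // s y; have := FG s y; rewrite /F /G => ->.
by rewrite -!scalemxAl -scalerA -scalerDr.
Qed.
End projections.

(** * From five dimensions to the whole space *)

Lemma diameter_max_width (R : realType) n (K : set 'rV[R]_n) (zeta : 'rV[R]_n) :
  convex_compact K -> usphere zeta -> has_diameter_parallel K zeta ->
  forall v, usphere v -> width K v <= width K zeta.
Proof.
move=> cK /[dup] uz /usphereP zz [z [y [[sK [u [uu umax] zyu]] [t zyt]]]] v uv.
apply: le_trans (umax v uv) _; rewrite -zyu zyt.
have Kz : K z.
  by apply: sK; exists 0; rewrite /= ?lexx ?ler01 ?subr0 ?scale1r ?scale0r ?addr0.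
have Ky : K y.
  by apply: sK; exists 1; rewrite /= ?lexx ?ler01 ?subrr ?scale1r ?scale0r ?add0r.
have nt : enorm (t *: zeta) = `|t|.
  by rewrite /enorm dotvZl dotvZr zz mulr1 -expr2 sqrtr_sqr.
have h1 := support_ge zeta cK Kz; have h2 := support_ge (- zeta) cK Ky.
have h3 := support_ge zeta cK Ky; have h4 := support_ge (- zeta) cK Kz.
have tE : dotv zeta z - dotv zeta y = t by rewrite -dotvBr zyt dotvZr zz mulr1.
rewrite nt /width; move: h2 h4; rewrite !dotvNl => h2 h4.
by case: (ger0P t) => _; lra.
Qed.

(** Gram-Schmidt for zeta, x, y and two zero vectors: the rows of J are the last
    four vectors of the result. *)
Lemma frames_exist (R : realType) n (zeta x y : 'rV[R]_n) : (5 <= n)%N ->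
  dotv zeta zeta = 1 ->
  exists2 J : 'M[R]_(4, n), J *m J^T = 1%:M /\ J *m zeta^T = 0 &
    exists s c t e, x = s *: zeta + c *m J /\ y = t *: zeta + e *m J.
Proof.
move=> hn zz.
have [J [JJ Jz [C [S VE]]]] := @orth_complete R (1 + (1 + 2)) 1 n zeta
  (col_mx x (col_mx y 0)) (zeta_gram zz) hn.
exists J => //.
have rowE i : row i (col_mx x (col_mx y 0)) = C i 0 *: zeta + row i S *m J.
  rewrite VE linearD /= !row_mul; congr (_ + _).
  by rewrite [row i C]mx11_scalar mul_scalar_mx mxE.
exists (C (lshift _ 0) 0), (row (lshift _ 0) S), (C (rshift 1 (lshift 2 0)) 0),
  (row (rshift 1 (lshift 2 0)) S); rewrite -!rowE; split.
  by apply/rowP => j; rewrite !mxE (unsplitK (inl 0 : 'I_1 + 'I_3)).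
apply/rowP => j; rewrite !mxE (unsplitK (inr _ : 'I_1 + 'I_3)) !mxE.
by rewrite (unsplitK (inl 0 : 'I_1 + 'I_2)).
Qed.

Unset Implicit Arguments.

Theorem corollary1 (R : realType) (n : nat) (hn : (5 <= n)%N)
    (K L : set 'rV[R]_n)
    (hK : convex_body K) (hL : convex_body L)
    (hKd : countably_many_diameters K) (hLd : countably_many_diameters L)
    (zeta : 'rV[R]_n) (hzeta : usphere zeta)
    (hKzeta : has_diameter_parallel K zeta)
    (hcongr : forall H : {vspace 'rV[R]_n}, \dim H = 4%N -> zeta \in H ->
       directly_congruent H (oproj K H) (oproj L H))
    (hsym : forall H : {vspace 'rV[R]_n}, \dim H = 4%N -> zeta \in H ->
       [/\ ~ has_SO_symmetry H (oproj K H),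
           ~ has_SO_symmetry H (oproj L H),
           ~ has_O_symmetry (H :&: orthv zeta)%VS
               (oproj K (H :&: orthv zeta)%VS)
         & ~ has_O_symmetry (H :&: orthv zeta)%VS
               (oproj L (H :&: orthv zeta)%VS)]) :
  exists b : 'rV[R]_n,
    K = translate L b \/ K = translate [set - x | x in L] b.
Proof.
have cK := convex_body_compact hK; have cL := convex_body_compact hL.
have zz : dotv zeta zeta = 1 by exact/usphereP.
have maxK := diameter_max_width cK hzeta hKzeta.
have asym H : \dim H = 4%N -> zeta \in H ->
    ~ has_O_symmetry (H :&: orthv zeta)%VS (oproj K (H :&: orthv zeta)%VS).
  by move=> dH zH; have [] := hsym H dH zH.
have frames x y := frames_exist x y hn zz.
have LKz := width_zeta cK cL hzeta hcongr maxK hLd frames.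
have maxL' v : usphere v -> width L v <= width L zeta.
  by rewrite LKz; exact: maxL cK cL hzeta hcongr maxK frames v.
have [pK bK] := midpoint_bounds cK hzeta maxK.
have [pL bL] := midpoint_bounds cL hzeta maxL'.
rewrite LKz in bL.
have main J fJ := signed_eq_on_frame cK cL hzeta hcongr asym maxK hLd frames
  (J := J) fJ bK bL.
pose F v := support_fun K v - dotv pK v; pose G v := support_fun L v - dotv pL v.
have [FG|FG] : (forall v, F v = G v) \/ (forall v, F v = G (- v)).
  apply: contrapT => /not_orP[/existsNP[x Fx] /existsNP[y Fy]].
  have [J fJ [s [c [t [e [xE yE]]]]]] := frames x y.
  have [eps [->|->] h] := main J fJ.
    by apply: Fx; have := h s c; rewrite -xE scale1r.
  by apply: Fy; have := h t e; rewrite -yE scaleN1r.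
- exists (pK - pL); left; apply: support_translate => // v.
  by have := FG v; rewrite /F /G dotvBr (dotvC v) (dotvC v); lra.
- have [cN hN] := convex_compact_opp cL.
  exists (pK + pL); right; apply: support_translate => // v.
  by have := FG v; rewrite /F /G hN dotvNr dotvDr (dotvC v) (dotvC v); lra.
Qed.
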